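(* Let $n\geq 2$ and let $D\subset\mathbb{C}^n$ be a non-degenerate convex domain. Then the quotient invariant $q_D = c_D/k_D$ satisfies, for every $z\in D$, $$q_D(z)\geq \left(\frac{3}{4n(4^n-1)}\right)^n.$$
   Context: A domain is a nonempty connected open set. A domain $D\subset\mathbb{C}^n$ is non-degenerate if it contains no complex lines (complex affine lines). $\mathbb{B}^n$ is the open unit ball of $\mathbb{C}^n$, $\mathcal{O}(X,Y)$ is the set of holomorphic maps from $X$ to $Y$, and $\det\psi'$ is the complex Jacobian determinant of a holomorphic map $\psi$. The Carathéodory and Kobayashi-Eisenman volume elements of a domain $D\subset \mathbb{C}^n$ at $z^0\in D$ are $$c_D(z^0)=\sup\{|\det\psi'(z^0)|^2:\psi\in\mathcal{O}(D,\mathbb{B}^n),\ \psi(z^0)=0\},$$ $$k_D(z^0)=\inf\{|\det\psi'(0)|^{-2}:\psi\in\mathcal{O}(\mathbb{B}^n,D),\ \psi(0)=z^0\}$$ (with $|\det\psi'(0)|^{-2}=+\infty$ if $\det\psi'(0)=0$). When $k_D$ is non-vanishing, the quotient invariant is $q_D(z)=c_D(z)/k_D(z)$, $z\in D$. *)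

(* Defs.v *)
From HB Require Import structures.
From mathcomp Require Import all_boot all_order all_algebra.
From mathcomp Require Import all_classical all_reals all_analysis.
From mathcomp Require Import complex.

Set Implicit Arguments.
Unset Strict Implicit.
Unset Printing Implicit Defensive.

Import Order.TTheory GRing.Theory Num.Theory.
Import numFieldNormedType.Exports.
Import Normc.

Local Open Scope classical_set_scope.
Local Open Scope ring_scope.

(* The library puts a topology only on the alias R[i]^o. Copying it to R[i]
   makes 'rV[R[i]]_n a topological space whose topology is convertible to the
   one underlying its canonical normedModType R[i] structure (sup norm). *)
HB.instance Definition _ (R : realType) :=
  PseudoMetricNormedZmod.copy R[i] R[i]^o.

Definition domain (R : realType) (n : nat) (D : set 'rV[R[i]]_n) : Prop :=
  [/\ D !=set0, open D & connected D].

Definition nondegenerate_domain (R : realType) (n : nat) (D : set 'rV[R[i]]_n)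
    : Prop :=
  ~ exists a v : 'rV[R[i]]_n, v != 0 /\ forall t : R[i], D (a + t *: v).

(* The order of R[i] has x <= y only if y - x is a nonnegative real, so the
   weights {i01 R[i]} in convex_set are exactly the reals of [0, 1]. *)
Definition convex_domain (R : realType) (n : nat) (D : set 'rV[R[i]]_n)
    : Prop :=
  domain D /\ convex_set D.

Definition unit_ball (R : realType) (n : nat) : set 'rV[R[i]]_n :=
  [set z | \sum_(j < n) normc (z 0 j) ^+ 2 < 1].

(* O(X, Y) for X open: differentiable is Frechet differentiability over the
   scalar field R[i], and the values of f outside X are irrelevant. *)
Definition holomorphic_maps (R : realType) (n : nat) (X Y : set 'rV[R[i]]_n)
    : set ('rV[R[i]]_n -> 'rV[R[i]]_n) :=
  [set f | (forall z, X z -> differentiable f z) /\ f @` X `<=` Y].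

(* 'J acts on row vectors on the right, so it is the transpose of the usual
   Jacobian matrix; the determinant is the same. *)
Definition abs_jac2 (R : realType) (n : nat)
    (f : 'rV[R[i]]_n -> 'rV[R[i]]_n) (z : 'rV[R[i]]_n) : R :=
  normc (\det ('J f z)) ^+ 2.

Definition caratheodory_volume (R : realType) (n : nat)
    (D : set 'rV[R[i]]_n) (z0 : 'rV[R[i]]_n) : \bar R :=
  ereal_sup [set (abs_jac2 psi z0)%:E | psi in
    [set psi | holomorphic_maps D (@unit_ball R n) psi /\ psi z0 = 0]].

(* The inverse is that of \bar R, for which 0^-1 = +oo. *)
Definition kobayashi_volume (R : realType) (n : nat)
    (D : set 'rV[R[i]]_n) (z0 : 'rV[R[i]]_n) : \bar R :=
  ereal_inf [set ((abs_jac2 psi 0)%:E^-1)%E | psi in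
    [set psi | holomorphic_maps (@unit_ball R n) D psi /\ psi 0 = z0]].

(* The division is the one of R, where x / 0 = 0, and fine maps +oo to 0: the
   quotient is 0 whenever k_D vanishes or one of c_D, k_D is infinite, so a
   positive lower bound on it entails that none of this happens. *)
Definition quotient_invariant (R : realType) (n : nat)
    (D : set 'rV[R[i]]_n) (z : 'rV[R[i]]_n) : R :=
  fine (caratheodory_volume D z) / fine (kobayashi_volume D z).

(* Main.v *)
(* Translate z to 0. One builds vectors v_1, ..., v_n and linear forms
   l_1, ..., l_n by induction: v_k is any nonzero vector killed by
   l_1, ..., l_(k-1), scaled so that the closed disc spanned by v_k lies in D
   but the one spanned by (3/2) v_k does not (D contains no complex line), and
   Re l_k < 1 on D supports D at an exit point, so |l_k(v_k)| >= 2/3. The matrix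
   (l_k(v_j)) is triangular, hence |det V| |det L| >= (2/3)^n.
   By convexity w |-> sum_k w_k v_k / sqrt n maps the ball into D, and
   l/(2 - l) maps the half-plane Re l < 1 into the disc, so
   (l_k/(2 - l_k))_k / sqrt n maps D into the ball. This gives
   q_D >= (1/(9 n^2))^n, which is enough because 27 n <= 4 (4^n - 1).
   Finiteness of c_D and positivity of k_D follow from Cauchy's estimate for
   functions that are merely complex differentiable at each point; it is deduced
   from Goursat's argument applied to (f(e^zeta) - f(0)) e^(-zeta). *)

Require Import Defs.
From HB Require Import structures.
From mathcomp Require Import all_boot all_order all_algebra.
From mathcomp Require Import all_classical all_reals all_analysis.
From mathcomp Require Import perm complex ring lra zify.

Set Implicit Arguments.
Unset Strict Implicit.
Unset Printing Implicit Defensive.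

Import Order.TTheory GRing.Theory Num.Theory.
Import numFieldNormedType.Exports.
Import Normc.

Local Open Scope classical_set_scope.
Local Open Scope ring_scope.

(** * Goursat's theorem in real form *)

Section segment_integral.
Variable R : realType.
Implicit Types f g : R -> R.

Lemma continuous_segment_integrable f (a b : R) :
  {within `[a, b], continuous f} ->
  lebesgue_measure.-integrable `[a, b] (EFin \o f).
Proof.
by move=> cf; apply: continuous_compact_integrable => //; exact: segment_compact.
Qed.

Lemma Rintegral_segment_split f (a b c : R) : a <= b -> b <= c ->
  {within `[a, c], continuous f} ->
  \int[lebesgue_measure]_(x in `[a, c]) f x =
  \int[lebesgue_measure]_(x in `[a, b]) f x +
  \int[lebesgue_measure]_(x in `[b, c]) f x.
Proof.
move=> ab bc cf; have If := continuous_segment_integrable cf.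
have /= := @Rintegral_itvB _ f (BLeft a) (BRight c) b If.
rewrite !bnd_simp => /(_ ab bc); rewrite Rintegral_itv_obnd_cbnd; last first.
  apply: integrableS If => //.
  by apply: subset_itvr; rewrite bnd_simp.
by move=> <-; ring.
Qed.

(** Integrate the pointwise bound. It serves on opposite sides of a small rectangle, where [k] comes
    from the linear part, and on two vertical segments in Cauchy's estimate. *)
Lemma Rintegral_segment_approx f g (a b k M : R) : a <= b ->
  {within `[a, b], continuous f} -> {within `[a, b], continuous g} ->
  (forall x, a <= x <= b -> `|f x - g x - k| <= M) ->
  `|\int[lebesgue_measure]_(x in `[a, b]) f x -
    \int[lebesgue_measure]_(x in `[a, b]) g x - k * (b - a)| <= M * (b - a).
Proof.
move=> ab cf cg fgM.
have ck h : {within `[a, b], continuous (cst h : R -> R)}.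
  by apply: continuous_subspaceT => x; exact: cvg_cst.
have If := continuous_segment_integrable cf.
have Ig := continuous_segment_integrable cg.
have Ik h := continuous_segment_integrable (ck h).
have cstE h : \int[lebesgue_measure]_(x in `[a, b]) h = h * (b - a).
  rewrite Rintegral_cst//= lebesgue_measure_itv/= lte_fin.
  by case: ltgtP ab => // -> _; rewrite subrr.
have Ifg : lebesgue_measure.-integrable `[a, b] (EFin \o (fun x => f x - g x)).
  exact: (integrableB _ If Ig).
have Ifgk : lebesgue_measure.-integrable `[a, b] (EFin \o (fun x => f x - g x - k)).
  exact: (integrableB _ Ifg (Ik k)).
rewrite -(cstE k) -(cstE M) -RintegralB// -RintegralB//; last exact: (Ik k).
apply: le_trans (le_normr_Rintegral _ _) _ => //.
apply: le_Rintegral => //.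
- exact: (integrable_norm Ifgk).
- exact: (Ik M).
Qed.

End segment_integral.

(** * Bisection of rectangles *)

Section rectangle_bisection.
Variable R : realType.

Lemma nested_segments (u v : nat -> R) :
  (forall n, u n <= u n.+1) -> (forall n, v n.+1 <= v n) ->
  (forall n, u n <= v n) -> exists x, forall n, u n <= x <= v n.
Proof.
move=> uS vS uv.
have um : {homo u : n m / (n <= m)%N >-> n <= m} by exact/nondecreasing_seqP.
have vm : {homo v : n m / (n <= m)%N >-> n >= m} by exact/nonincreasing_seqP.
have uvm n m : u n <= v m.
  by rewrite (le_trans (um _ _ (leq_maxl n m)))// (le_trans (uv _))// vm// leq_maxr.
exists (sup (range u)) => n; apply/andP; split.
  by apply: ub_le_sup; [exists (v 0%N) => _ [m _ <-]|exists n].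
by apply: ge_sup; [exists (u 0%N), 0%N|move=> _ [m _ <-]].
Qed.

Lemma exists_half_pow_le (w e : R) : 0 < e -> exists n, w / 2 ^+ n <= e.
Proof.
move=> e0; exists (Num.bound (w / e)).
rewrite ler_pdivrMr ?exprn_gt0// mulrC -ler_pdivrMr//.
exact/ltW/upper_nthrootP.
Qed.

(** If [P] failed on the whole rectangle, it would fail on one of its quarters, and so on along a
    nested sequence. These rectangles shrink to a point, where the local hypothesis is violated. *)
Lemma rectangle_bisection (P : R -> R -> R -> R -> Prop) (a b c d : R) :
  a <= b -> c <= d ->
  (forall x0 x1 y0 y1, let x := (x0 + x1) / 2 in let y := (y0 + y1) / 2 in
    P x0 x y0 y -> P x x1 y0 y -> P x0 x y y1 -> P x x1 y y1 -> P x0 x1 y0 y1) ->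
  (forall x y, a <= x <= b -> c <= y <= d -> exists2 e, 0 < e &
    forall x0 x1 y0 y1, x0 <= x <= x1 -> y0 <= y <= y1 ->
      x1 - x0 <= e -> y1 - y0 <= e -> P x0 x1 y0 y1) ->
  P a b c d.
Proof.
move=> ab cd Psplit Ploc; apply: contrapT => nPabcd.
(* A tuple [(x0, x1, y0, y1)] encodes a rectangle, and [N] marks the bad ones. [half] makes the
   second segment the left or the right half of the first. *)
pose N (r : R * R * R * R) := ~ P r.1.1.1 r.1.1.2 r.1.2 r.2.
pose half (p q p' q' : R) := (p' = p /\ q' = (p + q) / 2) \/ (p' = (p + q) / 2 /\ q' = q).
pose child (r s : R * R * R * R) :=
  half r.1.1.1 r.1.1.2 s.1.1.1 s.1.1.2 /\ half r.1.2 r.2 s.1.2 s.2.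
have step (r : {r | N r}) : exists s : {r | N r}, child (sval r) (sval s).
  case: r => [[[[x0 x1] y0] y1] Nr] /=; apply: contrapT => nex.
  have Pch s : child (x0, x1, y0, y1) s -> P s.1.1.1 s.1.1.2 s.1.2 s.2.
    by move=> ch; apply: contrapT => Ns; apply: nex; exists (exist _ s Ns).
  apply: Nr; apply: Psplit.
  - by apply: (Pch (x0, (x0 + x1) / 2, y0, (y0 + y1) / 2)); split; left.
  - by apply: (Pch ((x0 + x1) / 2, x1, y0, (y0 + y1) / 2)); split; [right|left].
  - by apply: (Pch (x0, (x0 + x1) / 2, (y0 + y1) / 2, y1)); split; [left|right].
  - by apply: (Pch ((x0 + x1) / 2, x1, (y0 + y1) / 2, y1)); split; right.
have [F chF] := choice step.
pose s n := sval (iter n F (exist N (a, b, c, d) nPabcd)).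
have chs n : child (s n) (s n.+1) by exact: chF.
have Ns n : N (s n) by rewrite /s; case: (iter _ _ _).
have halves (u v : nat -> R) : u 0%N <= v 0%N ->
    (forall n, half (u n) (v n) (u n.+1) (v n.+1)) ->
    (forall n, v n - u n = (v 0%N - u 0%N) / 2 ^+ n) /\
    exists x, forall n, u n <= x <= v n.
  move=> uv0 uv.
  have w n : v n - u n = (v 0%N - u 0%N) / 2 ^+ n.
    elim: n => [|n IH]; first by rewrite expr0 divr1.
    rewrite exprS invfM mulrCA -IH.
    by case: (uv n) => -[-> ->]; lra.
  have uvn n : u n <= v n.
    by rewrite -subr_ge0 w divr_ge0// ?subr_ge0// exprn_ge0.
  split=> //; apply: nested_segments => // n; have := uvn n;
    by case: (uv n) => -[ue ve]; rewrite ?ue ?ve; lra.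
have [wx [x xP]] := halves (fun n => (s n).1.1.1) (fun n => (s n).1.1.2) ab
  (fun n => (chs n).1).
have [wy [y yP]] := halves (fun n => (s n).1.2) (fun n => (s n).2) cd
  (fun n => (chs n).2).
have [e e0 eP] := Ploc _ _ (xP 0%N) (yP 0%N).
have [n1 n1P] := exists_half_pow_le (b - a) e0.
have [n2 n2P] := exists_half_pow_le (d - c) e0.
have mono w n m : 0 <= w -> (n <= m)%N -> w / 2 ^+ m <= w / 2 ^+ n :> R.
  move=> w0 nm; rewrite ler_wpM2l// lef_pV2 ?posrE ?exprn_gt0//.
  by rewrite ler_eXn2l// ltr1n.
apply: (Ns (maxn n1 n2)); apply: eP => //.
- by rewrite wx (le_trans _ n1P)// mono ?subr_ge0 ?leq_maxl.
- by rewrite wy (le_trans _ n2P)// mono ?subr_ge0 ?leq_maxr.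
Qed.

End rectangle_bisection.

Section goursat.
Variable R : realType.
Implicit Types (f U V : R -> R -> R).

(** Real total differentiability at one point, in the l^1 norm; the partial derivatives need not be
    continuous. *)
Definition has_gradient f (x y p q : R) := forall e, 0 < e ->
  exists2 r, 0 < r & forall h k, `|h| <= r -> `|k| <= r ->
    `|f (x + h) (y + k) - f x y - (p * h + q * k)| <= e * (`|h| + `|k|).

Lemma has_gradient_continuous_l f x y p q : has_gradient f x y p q ->
  {for x, continuous (f ^~ y)}.
Proof.
move=> /(_ 1 ltr01)[r r0 fr]; apply/cvgrPdist_le => e e0.
have cvx : id @ x --> x by exact: cvg_id.
near=> t.
have tr : `|t - x| <= r.
  by rewrite distrC; near: t; exact: (cvgr_dist_le _ _ cvx).
have te : `|t - x| <= e / (`|p| + 1).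
  rewrite distrC; near: t; apply: (cvgr_dist_le _ _ cvx).
  by rewrite divr_gt0// ltr_wpDl.
have := fr (t - x) 0 tr; rewrite normr0 (ltW r0) => /(_ isT).
rewrite (addrC x) subrK mulr0 !addr0 mul1r => H.
rewrite distrC; move: te; rewrite ler_pdivlMr ?ltr_wpDl// => te.
have := ler_normD (f t y - f x y - p * (t - x)) (p * (t - x)).
rewrite subrK normrM; nra.
Unshelve. all: by end_near. Qed.

Lemma has_gradient_swap f x y p q : has_gradient f x y p q ->
  has_gradient (fun s t => f t s) y x q p.
Proof.
move=> fxy e /fxy[r r0 fr]; exists r => // h k hr kr.
by have := fr k h kr hr; rewrite (addrC (p * k)) (addrC `|k|).
Qed.

Lemma has_gradient_continuous_r f x y p q : has_gradient f x y p q ->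
  {for y, continuous (f x)}.
Proof. by move=> /has_gradient_swap/has_gradient_continuous_l. Qed.

(** The outward flux of the field (U, -V) through the boundary of the rectangle, which is also the
    imaginary part of the contour integral of U + iV. *)
Definition flux U V (a b c d : R) :=
  \int[lebesgue_measure]_(y in `[c, d]) U b y -
  \int[lebesgue_measure]_(y in `[c, d]) U a y -
  (\int[lebesgue_measure]_(x in `[a, b]) V x d -
   \int[lebesgue_measure]_(x in `[a, b]) V x c).

Lemma dist_segment (u0 u1 u t : R) :
  u0 <= u <= u1 -> u0 <= t <= u1 -> `|t - u| <= u1 - u0.
Proof.
by move=> /andP[? ?] /andP[? ?]; rewrite ler_norml; apply/andP; split; lra.
Qed.

(** The hypothesis contains the Cauchy-Riemann equation U_x = V_y, so (U, -V) has zero divergence.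
    On a small rectangle the linear parts of [U] and [V] cancel, leaving an error of order [e] times
    the squared half-perimeter; bisection spreads this bound to the whole rectangle. *)
Lemma goursat U V (a b c d : R) : a <= b -> c <= d ->
  (forall x y, a <= x <= b -> c <= y <= d -> exists p q r,
    has_gradient U x y p q /\ has_gradient V x y r p) ->
  flux U V a b c d = 0.
Proof.
move=> ab cd UV.
have cU x c' d' : a <= x <= b -> c <= c' -> d' <= d ->
    {within `[c', d'], continuous (U x)}.
  move=> xab cc dd; apply: continuous_in_subspaceT => y.
  rewrite inE/= in_itv/= => /andP[y1 y2].
  have [|p [q [r [Uxy _]]]] := UV x y xab.
    by rewrite (le_trans cc y1) (le_trans y2 dd).
  exact: has_gradient_continuous_r Uxy.
have cV y a' b' : c <= y <= d -> a <= a' -> b' <= b ->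
    {within `[a', b'], continuous (V ^~ y)}.
  move=> ycd aa bb; apply: continuous_in_subspaceT => x.
  rewrite inE/= in_itv/= => /andP[x1 x2].
  have [|p [q [r [_ Vxy]]]] := UV x y _ ycd.
    by rewrite (le_trans aa x1) (le_trans x2 bb).
  exact: has_gradient_continuous_l Vxy.
pose P e x0 x1 y0 y1 := [/\ a <= x0, x0 <= x1 & x1 <= b] ->
  [/\ c <= y0, y0 <= y1 & y1 <= d] ->
  `|flux U V x0 x1 y0 y1| <= e * ((x1 - x0) + (y1 - y0)) ^+ 2.
(* The squared half-perimeter of a rectangle is the sum of those of its four
   quarters, so the bound [P] is inherited under bisection. *)
suff H e : 0 < e -> P e a b c d.
  apply/normr0_eq0/le_anti/andP; split=> //.
  apply/ler_addgt0Pr => e e0; rewrite add0r.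
  pose s := ((b - a) + (d - c)) ^+ 2 + 1.
  have s0 : 0 < s by rewrite ltr_wpDl ?sqr_ge0.
  have := H _ (divr_gt0 e0 s0); rewrite /P => /(_ (And3 (lexx _) ab (lexx _))).
  move=> /(_ (And3 (lexx _) cd (lexx _)))/le_trans; apply.
  by rewrite mulrAC ler_pdivrMr// ler_pM2l// /s; lra.
move=> e0; apply: rectangle_bisection => //.
  move=> x0 x1 y0 y1 x y P1 P2 P3 P4 [ax0 x01 x1b] [cy0 y01 y1d].
  have x0x : x0 <= x by rewrite /x; lra.
  have xx1 : x <= x1 by rewrite /x; lra.
  have y0y : y0 <= y by rewrite /y; lra.
  have yy1 : y <= y1 by rewrite /y; lra.
  have fluxE : flux U V x0 x1 y0 y1 =
     flux U V x0 x y0 y + flux U V x x1 y0 y +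
     flux U V x0 x y y1 + flux U V x x1 y y1.
    rewrite /flux.
    rewrite (@Rintegral_segment_split _ (U x1) y0 y y1)//; last by apply: cU; lra.
    rewrite (@Rintegral_segment_split _ (U x0) y0 y y1)//; last by apply: cU; lra.
    rewrite (@Rintegral_segment_split _ (V ^~ y1) x0 x x1)//; last by apply: cV; lra.
    rewrite (@Rintegral_segment_split _ (V ^~ y0) x0 x x1)//; last by apply: cV; lra.
    lra.
  have B1 := P1 (And3 ax0 x0x (le_trans xx1 x1b)) (And3 cy0 y0y (le_trans yy1 y1d)).
  have B2 := P2 (And3 (le_trans ax0 x0x) xx1 x1b) (And3 cy0 y0y (le_trans yy1 y1d)).
  have B3 := P3 (And3 ax0 x0x (le_trans xx1 x1b)) (And3 (le_trans cy0 y0y) yy1 y1d).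
  have B4 := P4 (And3 (le_trans ax0 x0x) xx1 x1b) (And3 (le_trans cy0 y0y) yy1 y1d).
  rewrite fluxE.
  apply: le_trans (ler_normD _ _) _; apply: le_trans (lerD (ler_normD _ _) B4) _.
  apply: le_trans (lerD (lerD (ler_normD _ _) B3) (lexx _)) _.
  apply: le_trans (lerD (lerD (lerD B1 B2) (lexx _)) (lexx _)) _.
  by rewrite le_eqVlt /x /y; apply/orP; left; apply/eqP; field.
move=> x y xab ycd.
have [p [q [r [Ux Vx]]]] := UV x y xab ycd.
have e2 : 0 < e / 2 by lra.
have [r1 r10 Ur] := Ux _ e2.
have [r2 r20 Vr] := Vx _ e2.
exists (Num.min r1 r2); first by rewrite lt_min r10.
move=> x0 x1 y0 y1 xx yy; rewrite !le_min => /andP[xr1 xr2] /andP[yr1 yr2].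
move=> [ax0 x01 x1b] [cy0 y01 y1d].
set w := x1 - x0 + (y1 - y0).
have estU t s : x0 <= t <= x1 -> y0 <= s <= y1 ->
    `|U t s - U x y - (p * (t - x) + q * (s - y))| <= e / 2 * w.
  move=> tx sy; have dx := dist_segment xx tx; have dy := dist_segment yy sy.
  have := Ur _ _ (le_trans dx xr1) (le_trans dy yr1).
  rewrite !(addrC _ (_ - _)) !subrK => /le_trans; apply.
  by rewrite ler_pM2l// lerD.
have estV t s : x0 <= t <= x1 -> y0 <= s <= y1 ->
    `|V t s - V x y - (r * (t - x) + p * (s - y))| <= e / 2 * w.
  move=> tx sy; have dx := dist_segment xx tx; have dy := dist_segment yy sy.
  have := Vr _ _ (le_trans dx xr2) (le_trans dy yr2).
  rewrite !(addrC _ (_ - _)) !subrK => /le_trans; apply.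
  by rewrite ler_pM2l// lerD.
have x0ab : a <= x0 <= b by rewrite ax0 (le_trans x01).
have x1ab : a <= x1 <= b by rewrite x1b (le_trans ax0).
have y0cd : c <= y0 <= d by rewrite cy0 (le_trans y01).
have y1cd : c <= y1 <= d by rewrite y1d (le_trans cy0).
have Ib : x0 <= x1 <= x1 by rewrite x01 lexx.
have Ia : x0 <= x0 <= x1 by rewrite x01 lexx.
have Jb : y0 <= y1 <= y1 by rewrite y01 lexx.
have Ja : y0 <= y0 <= y1 by rewrite y01 lexx.
(* In the difference of the two sides the terms in [q] cancel, leaving the constant [p * (x1 - x0)];
   two errors of [e / 2 * w] add up to [e * w]. Its main term, [p] times the area, is the same in
   [BV]. *)
have BU : `|\int[lebesgue_measure]_(y in `[y0, y1]) U x1 y -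
  \int[lebesgue_measure]_(y in `[y0, y1]) U x0 y - p * (x1 - x0) * (y1 - y0)|
    <= e * w * (y1 - y0).
  apply: Rintegral_segment_approx; [exact: y01|exact: cU|exact: cU|].
  move=> s sy.
  have := ler_normB (U x1 s - U x y - (p * (x1 - x) + q * (s - y)))
    (U x0 s - U x y - (p * (x0 - x) + q * (s - y))).
  have := estU _ _ Ib sy; have := estU _ _ Ia sy.
  set A := `|_|; set B := `|_| => h1 h2.
  rewrite (_ : _ - _ - _ = U x1 s - U x0 s - p * (x1 - x0)); last by ring.
  by move=> /le_trans; apply; rewrite [e]splitr mulrDl lerD.
have BV : `|\int[lebesgue_measure]_(x in `[x0, x1]) V x y1 -
  \int[lebesgue_measure]_(x in `[x0, x1]) V x y0 - p * (y1 - y0) * (x1 - x0)|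
    <= e * w * (x1 - x0).
  apply: (@Rintegral_segment_approx _ (V ^~ y1) (V ^~ y0));
    [exact: x01|exact: cV|exact: cV|].
  move=> s sx.
  have := ler_normB (V s y1 - V x y - (r * (s - x) + p * (y1 - y)))
    (V s y0 - V x y - (r * (s - x) + p * (y0 - y))).
  have := estV _ _ sx Jb; have := estV _ _ sx Ja.
  set A := `|_|; set B := `|_| => h1 h2.
  rewrite (_ : _ - _ - _ = V s y1 - V s y0 - p * (y1 - y0)); last by ring.
  by move=> /le_trans; apply; rewrite [e]splitr mulrDl lerD.
rewrite /flux.
move: BU BV; set IU := (X in X - _ * _ * _) => BU; set IV := (X in X - _ * _ * _) => BV.
have -> : IU - IV = (IU - p * (x1 - x0) * (y1 - y0)) - (IV - p * (y1 - y0) * (x1 - x0)).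
  by ring.
apply: le_trans (ler_normB _ _) _; apply: le_trans (lerD BU BV) _.
by rewrite -mulrDr (addrC (y1 - y0)) -/w -mulrA -expr2.
Qed.

End goursat.

(** * Cauchy's estimate *)

(** With the converses [approx_differentiable] and [approx_diff1], this trades one-variable
    differentiability for an inequality, over the reals and the complex numbers alike. *)
Lemma differentiable_approx (K : numFieldType) (f : K^o -> K^o) (x : K) :
  differentiable f x -> forall e : K, 0 < e -> exists2 r : K, 0 < r &
    forall h, `|h| <= r -> `|f (x + h) - f x - 'd f x 1 * h| <= e * `|h|.
Proof.
move=> fx e e0; have /diff_locally/eqaddoP/(_ e e0) := fx.
move=> /nbhs_ballP[r /= r0 fr].
exists (r / 2); first by rewrite divr_gt0.
move=> h hr; have /= := fr h; rewrite -ball_normE/= sub0r normrN.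
have -> : `|h| < r by rewrite (le_lt_trans hr)// ltr_pdivrMr// ltr_pMr// ltr1n.
rewrite (_ : (f \o shift x - _) h = f (x + h) - f x - 'd f x 1 * h) => [/(_ isT)//|].
rewrite !fctE /= (addrC h) opprD addrA -{2}(mulr1 h) [h * 1](_ : _ = h *: (1 : K^o))//.
by rewrite linearZ_LR; congr (_ - _); exact: mulrC.
Qed.

Lemma approx_cvg (K : numFieldType) (f : K^o -> K^o) (x l : K) :
  (forall e : K, 0 < e -> exists2 r : K, 0 < r &
    forall h, `|h| <= r -> `|f (x + h) - f x - l * h| <= e * `|h|) ->
  h^-1 *: (f (h *: 1 + x) - f x) @[h --> 0^'] --> (l : K^o).
Proof.
move=> fl; apply/cvgrPdist_le => e e0.
have [r r0 fr] := fl e e0; apply/nbhs_ballP; exists r => //= h.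
rewrite -ball_normE/= sub0r normrN => hr h0.
have := fr h (ltW hr); rewrite -ler_pdivrMr ?normr_gt0//; apply: le_trans.
rewrite -normf_div distrC /= [h *: 1]mulr1 (addrC h) mulrBl mulfK// [_ *: _]mulrC.
by [].
Qed.

Lemma approx_differentiable (K : numFieldType) (f : K^o -> K^o) (x l : K) :
  (forall e : K, 0 < e -> exists2 r : K, 0 < r &
    forall h, `|h| <= r -> `|f (x + h) - f x - l * h| <= e * `|h|) ->
  differentiable f x.
Proof.
by move=> fl; apply/derivable1_diffP/cvg_ex; exists l; exact: approx_cvg.
Qed.

Lemma approx_diff1 (K : numFieldType) (f : K^o -> K^o) (x l : K) :
  (forall e : K, 0 < e -> exists2 r : K, 0 < r &
    forall h, `|h| <= r -> `|f (x + h) - f x - l * h| <= e * `|h|) ->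
  'd f x 1 = l.
Proof.
move=> fl; rewrite -deriveE; last exact: approx_differentiable fl.
by apply: cvg_lim => //; exact: approx_cvg.
Qed.

Section complex_modulus.
Variable R : realType.
Implicit Types z w : R[i].
Local Open Scope complex_scope.

(** Converts tolerances and radii living in [R[i]] into real ones. *)
Lemma Re_real_pos z : 0 < z -> z = (complex.Re z)%:C /\ 0 < complex.Re z.
Proof. by case: z => a b; rewrite ltcE/= => /andP[/eqP-> ->]. Qed.

Lemma normE z : `|z| = (normc z)%:C.
Proof. by []. Qed.

Lemma normc_ge0 (z : R[i]) : 0 <= normc z.
Proof. by have := normr_ge0 z; rewrite normE ler0c. Qed.

Lemma normcR (r : R) : 0 <= r -> normc r%:C = r.
Proof. by move=> r0; rewrite /normc/= expr0n addr0 sqrtr_sqr ger0_norm. Qed.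

Lemma normc_le_add z : normc z <= `|complex.Re z| + `|complex.Im z|.
Proof.
case: z => a b /=.
rewrite -[leRHS]ger0_norm ?addr_ge0// -sqrtr_sqr ler_wsqrtr//.
rewrite sqrrD !real_normK ?num_real// addrAC lerDl.
by rewrite mulrn_wge0// mulr_ge0.
Qed.

Lemma ge_Re_normc z : `|complex.Re z| <= normc z.
Proof. by have := normc_ge_Re z; rewrite normE lecR. Qed.

Lemma ge_Im_normc z : `|complex.Im z| <= normc z.
Proof.
case: z => a b /=; rewrite -sqrtr_sqr ler_wsqrtr//.
by rewrite lerDr sqr_ge0.
Qed.

End complex_modulus.

(** * The complex exponential *)

Section cexp.
Variable R : realType.
Implicit Types z w : R[i].
Local Open Scope complex_scope.

Definition cexp z : R[i] :=
  (expR (complex.Re z) * cos (complex.Im z)) +i*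
  (expR (complex.Re z) * sin (complex.Im z)).

Lemma cexpD z w : cexp (z + w) = cexp z * cexp w.
Proof.
case: z w => [a b] [c d]; rewrite /cexp/=; simpc; rewrite expRD cosD sinD.
by congr (_ +i* _); ring.
Qed.

Lemma cexp0 : cexp 0 = 1.
Proof. by rewrite /cexp/= expR0 cos0 sin0 mulr1 mulr0. Qed.

Lemma cexp_neq0 z : cexp z != 0.
Proof.
by apply/eqP => z0; have := cexpD z (- z); rewrite subrr cexp0 z0 mul0r => /eqP;
  rewrite oner_eq0.
Qed.

Lemma normc_cexp z : normc (cexp z) = expR (complex.Re z).
Proof.
rewrite /cexp/= !exprMn -mulrDr cos2Dsin2 mulr1 sqrtr_sqr ger0_norm//.
Qed.

(** The real and imaginary parts are expanded from the real derivatives of [expR], [cos] and [sin]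
    at 0. *)
Lemma cexp_approx0 (e : R[i]) : 0 < e -> exists2 r : R[i], 0 < r &
  forall h, `|h| <= r -> `|cexp (0 + h) - cexp 0 - 1 * h| <= e * `|h|.
Proof.
move=> /Re_real_pos[-> ]; move: (complex.Re e) => {}e e0.
(* The bounds [B1] to [B5] below consume 1, 1, 2, 2 and 1 sevenths of [e]. *)
have e7 : 0 < e / 7 by rewrite divr_gt0.
have dE : differentiable (expR : R^o -> R^o) 0 by apply/derivable1_diffP.
have dC : differentiable (cos : R^o -> R^o) 0.
  by apply/derivable1_diffP; exact: derivable_cos.
have dS : differentiable (sin : R^o -> R^o) 0.
  by apply/derivable1_diffP; exact: derivable_sin.
have [r1 r10 E] := differentiable_approx dE e7.
have [r2 r20 C] := differentiable_approx dC e7.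
have [r3 r30 S] := differentiable_approx dS e7.
have eE : 'd (expR : R^o -> R^o) 0 1 = 1.
  by rewrite -deriveE// derive_val expR0.
have eC : 'd (cos : R^o -> R^o) 0 1 = 0.
  by rewrite -deriveE// derive_val sin0 oppr0.
have eS : 'd (sin : R^o -> R^o) 0 1 = 1.
  by rewrite -deriveE// derive_val cos0.
(* The bound 1 gives [|1 + x| <= 2], and [e / 7] controls the product [x * y]. *)
exists (Num.min 1 (Num.min (e / 7) (Num.min r1 (Num.min r2 r3))))%:C.
  by rewrite ltcR !lt_min ltr01 e7 r10 r20.
move=> h; rewrite !normE lecR -rmorphM lecR.
rewrite !le_min => /and5P[h1 he hr1 hr2 hr3].
rewrite add0r cexp0 mul1r.
apply: le_trans (normc_le_add _) _.
have := ge_Re_normc h; have := ge_Im_normc h.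
move: (normc h) h1 he hr1 hr2 hr3 => N h1 he hr1 hr2 hr3.
case: h => x y /= yN xN; rewrite oppr0 addr0.
have := E x (le_trans xN hr1); rewrite add0r expR0 eE mul1r.
have := C y (le_trans yN hr2); rewrite add0r cos0 eC mul0r subr0.
have := S y (le_trans yN hr3); rewrite add0r sin0 eS mul1r subr0.
set s := _ - y; set c := _ - 1; set E' := _ - x => hs hc hE.
have -> : expR x * cos y - 1 - x = E' * cos y + (1 + x) * c by rewrite /E' /c; ring.
have -> : expR x * sin y - y = E' * sin y + (1 + x) * s + x * y.
  by rewrite /E' /s; ring.
have x1 : `|1 + x| <= 2.
  apply: le_trans (ler_normD _ _) _.
  by rewrite normr1 (natrD _ 1 1) lerD// (le_trans xN).
have cy : `|cos y| <= 1 by rewrite cos_max.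
have sy : `|sin y| <= 1 by rewrite sin_max.
apply: le_trans (lerD (ler_normD _ _) (ler_normD _ _)) _.
apply: le_trans (lerD (lexx _) (lerD (ler_normD _ _) (lexx _))) _.
rewrite !normrM.
have N0 : 0 <= N by apply: le_trans xN.
have B1 : `|E'| * `|cos y| <= e / 7 * N.
  apply: le_trans (ler_piMr _ cy) _ => //; apply: le_trans hE _.
  by rewrite ler_wpM2l// ltW.
have B2 : `|E'| * `|sin y| <= e / 7 * N.
  apply: le_trans (ler_piMr _ sy) _ => //; apply: le_trans hE _.
  by rewrite ler_wpM2l// ltW.
have B3 : `|1 + x| * `|c| <= 2 * (e / 7 * N).
  by apply: ler_pM => //; apply: le_trans hc _; rewrite ler_wpM2l// ltW.
have B4 : `|1 + x| * `|s| <= 2 * (e / 7 * N).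
  by apply: ler_pM => //; apply: le_trans hs _; rewrite ler_wpM2l// ltW.
have B5 : `|x| * `|y| <= e / 7 * N by apply: ler_pM => //; exact: le_trans he.
by clearbody s c E'; clear -B1 B2 B3 B4 B5; lra.
Qed.

Lemma differentiable_cexp z : differentiable (cexp : R[i]^o -> R[i]^o) z.
Proof.
(* The functional equation moves the question to the origin. *)
have -> : cexp = (fun w => cexp z *: (cexp (w - z) : R[i]^o)) :> (R[i]^o -> R[i]^o).
  by apply/funext => w; rewrite -[RHS]/(cexp z * cexp (w - z)) -cexpD subrKC.
apply: differentiableZ.
apply: (@differentiable_comp _ _ _ _ (fun w : R[i]^o => w - z : R[i]^o)
  (cexp : R[i]^o -> R[i]^o)) => //.
apply: (@approx_differentiable _ _ _ 1) => e e0; rewrite subrr.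
exact: cexp_approx0.
Qed.

End cexp.

Section cauchy_estimate.
Local Open Scope complex_scope.
Variable R : realType.
Implicit Types (f : R[i]^o -> R[i]^o) (z : R[i]).

(** The Cauchy-Riemann equations: if the derivative is p + iq, its product with h + ik is (p h - q
    k) + i (q h + p k). *)
Lemma differentiable_gradient f (x y : R) : differentiable f (x +i* y) ->
  exists p q, has_gradient (fun s t => complex.Re (f (s +i* t))) x y p (- q) /\
              has_gradient (fun s t => complex.Im (f (s +i* t))) x y q p.
Proof.
move=> /differentiable_approx df.
set d := 'd f _ 1 in df.
have appr e : 0 < e -> exists2 r, 0 < r & forall h k, `|h| <= r -> `|k| <= r ->
    normc (f ((x + h) +i* (y + k)) - f (x +i* y) - d * (h +i* k)) <= e * (`|h| + `|k|).
  move=> e0; have [|r /Re_real_pos[-> r0] fr] := df e%:C; first by rewrite ltcR.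
  exists (complex.Re r / 2) => [|h k hr kr]; first by rewrite divr_gt0.
  have hk := normc_le_add (h +i* k).
  have := fr (h +i* k); rewrite !normE -rmorphM !lecR => /(_ _)/le_trans.
  apply; first by apply: le_trans hk _; rewrite /=; lra.
  by rewrite ler_pM2l.
exists (complex.Re d), (complex.Im d); split=> e /appr[r r0 fr]; exists r => // h k hr kr;
  apply: le_trans (fr h k hr kr).
- apply: le_trans (ge_Re_normc _); rewrite le_eqVlt; apply/orP; left; apply/eqP.
  congr `|_|; rewrite !raddfB/=; congr (_ - _ - _).
  by case: d {fr appr df} => a b /=; simpc => /=; ring.
- apply: le_trans (ge_Im_normc _); rewrite le_eqVlt; apply/orP; left; apply/eqP.
  congr `|_|; rewrite !raddfB/=; congr (_ - _ - _).
  by case: d {fr appr df} => a b /=; simpc => /=; ring.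
Qed.

(* [G w = c (f (e^w) - f 0) / e^w] is 2 pi i-periodic, so its mean over a vertical
   segment of length 2 pi does not depend on [Re w]; it tends to [c f'(0)] as
   [Re w] tends to -oo. *)
Lemma Re_cauchy_estimate f (c : R[i]) (r M : R) : normc c = 1 -> 0 < r ->
  (forall z, normc z < r -> differentiable f z) ->
  (forall z, normc z < r -> normc (f z) <= M) ->
  `|complex.Re (c * 'd f 0 1)| <= 4 * M / r.
Proof.
move=> c1 r0 fd fM; set d := 'd f 0 1.
apply/ler_addgt0Pr => e e0.
have d0 : differentiable f 0 by apply: fd; rewrite normc0.
have [|dl /Re_real_pos[-> dl0] fdl] := differentiable_approx d0 (e := e%:C).
  by rewrite ltcR.
have r2 : 0 < r / 2 by rewrite divr_gt0.
(* The exponential sends the line Re w = b to the circle of radius [r / 2], and Re w = a to a circle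
   so small that the expansion of [f] at 0 holds on it with error [e]. *)
pose b := ln (r / 2); pose a := Num.min b (ln (complex.Re dl)).
have ab : a <= b by rewrite ge_min lexx.
pose G : R[i]^o -> R[i]^o :=
  cst (c : R[i]^o) * (f \o (@cexp R : R[i]^o -> R[i]^o) - cst (f 0)) *
  (fun w => (cexp w : R[i]^o)^-1).
have GE w : G w = c * (f (cexp w) - f 0) / cexp w by [].
pose U s t := complex.Re (G (s +i* t)); pose V s t := complex.Im (G (s +i* t)).
have expb s : s <= b -> expR s <= r / 2.
  by move=> sb; rewrite -[leRHS]lnK ?posrE// ler_expR.
have cexpr s t : s <= b -> normc (cexp (s +i* t)) < r.
  by move=> /expb sb; rewrite normc_cexp/= (le_lt_trans sb)//; lra.
have dG s t : s <= b -> differentiable G (s +i* t).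
  move=> sb.
  have dF : differentiable (f \o (@cexp R : R[i]^o -> R[i]^o)) (s +i* t).
    exact: differentiable_comp (differentiable_cexp _) (fd _ (cexpr s t sb)).
  have dN := differentiableV (differentiable_cexp (s +i* t)) (cexp_neq0 _).
  have dA := differentiableB dF (differentiable_cst (f 0) (s +i* t : R[i]^o)).
  have dc := differentiable_cst (c : R[i]^o) (s +i* t : R[i]^o).
  exact: differentiableM (differentiableM dc dA) dN.
have pi2_gt0 : 0 < pi *+ 2 :> R by rewrite pmulrn_lgt0// pi_gt0.
have pi20 := ltW pi2_gt0.
have flux0 : flux U V a b 0 (pi *+ 2) = 0.
  apply: goursat => // x y /andP[_ xb] _.
  have [p [q [Ux Vx]]] := differentiable_gradient (dG x y xb).
  by exists p, (- q), q.
(* By periodicity the two horizontal sides cancel in the flux. *)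
have Vper x : V x (pi *+ 2) = V x 0.
  by rewrite /V !GE /cexp/= cos2pi sin2pi cos0 sin0.
have cU s : s <= b -> {within `[0, pi *+ 2], continuous (U s)}.
  move=> sb; apply: continuous_in_subspaceT => y _.
  have [p [q [Ux _]]] := differentiable_gradient (dG s y sb).
  exact: has_gradient_continuous_r Ux.
(* Here [f - f 0] is at most [2 * M] in modulus and the denominator has modulus [r / 2]. *)
have Gb t : normc (G (b +i* t)) <= 4 * M / r.
  rewrite GE !normcM c1 mul1r normcV normc_cexp/= /b lnK ?posrE// ler_pdivrMr//.
  rewrite (_ : 4 * M / r * (r / 2) = M + M); last by field; rewrite gt_eqF.
  apply: le_trans (le_normcD _ _) _; rewrite normcN lerD// fM ?normc0//.
  exact: cexpr.
have Ga t : normc (G (a +i* t) - c * d) <= e.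
  set w := cexp (a +i* t).
  have -> : G (a +i* t) - c * d = c * (f (0 + w) - f 0 - d * w) / w.
    have alg (A B : R[i]) : c * A / w - c * B = c * (A - B * w) / w.
      by field; exact: cexp_neq0.
    by rewrite GE add0r; exact: alg.
  rewrite !normcM c1 mul1r normcV.
  have wE : normc w = expR a by rewrite normc_cexp.
  have := fdl w; rewrite !normE -rmorphM !lecR wE => /(_ _) H.
  rewrite ler_pdivrMr ?expR_gt0// H//.
  by rewrite -[leRHS]lnK ?posrE// ler_expR ge_min lexx orbT.
have := @Rintegral_segment_approx _ (U b) (U a) 0 (pi *+ 2) (- complex.Re (c * d))
  (4 * M / r + e) pi20 (cU _ (lexx b)) (cU _ ab).
have -> : \int[lebesgue_measure]_(x in `[0, pi *+ 2]) U b x -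
          \int[lebesgue_measure]_(x in `[0, pi *+ 2]) U a x = 0.
  move: flux0; rewrite /flux.
  have -> : (fun x => V x (pi *+ 2)) = V ^~ 0 by apply/funext => x; exact: Vper.
  by rewrite [X in _ - X = _]subrr subr0.
rewrite sub0r subr0 normrN normrM normrN (ger0_norm pi20).
rewrite ler_pM2r//; apply => x _.
rewrite opprK -addrA; apply: le_trans (ler_normD _ _) _; apply: lerD.
  exact: le_trans (ge_Re_normc _) (Gb x).
rewrite addrC distrC; apply: le_trans (Ga x).
by apply: le_trans (ge_Re_normc _); rewrite raddfB.
Qed.

(** Taking [c = 1] and [c = -i] bounds the real and the imaginary part of the derivative; adding the
    two doubles the constant 4. Only finiteness of the bound matters later. *)
Lemma cauchy_estimate f (r M : R) : 0 < r ->
  (forall z, normc z < r -> differentiable f z) ->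
  (forall z, normc z < r -> normc (f z) <= M) ->
  normc ('d f 0 1) <= 8 * M / r.
Proof.
move=> r0 fd fM.
apply: le_trans (normc_le_add _) _.
have -> : 8 * M / r = 4 * M / r + 4 * M / r by field; rewrite gt_eqF.
have nI : normc (0 +i* (- 1) : R[i]) = 1.
  by rewrite /normc/= expr0n add0r sqrrN expr1n sqrtr1.
have := Re_cauchy_estimate nI r0 fd fM.
have := Re_cauchy_estimate (normc1 R) r0 fd fM.
rewrite mul1r; case: ('d f 0 1) => u v /=.
rewrite mul0r sub0r mulN1r opprK; exact: lerD.
Qed.

End cauchy_estimate.

(** * Convex domains *)

Section separation.
Local Open Scope complex_scope.
Variable R : realType.

Section real_graph.
Variables (V : lmodType R[i]) (D : set V).
Hypothesis convD : forall x y (s t : R), 0 <= s -> 0 <= t -> s + t = 1 ->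
  D x -> D y -> D (s%:C *: x + t%:C *: y).
Hypothesis absD : forall x, exists2 e : R, 0 < e & D (e%:C *: x).

(* A partially defined real-linear form, bounded by 1 on [D], is encoded by its
   graph: extending it by one vector then needs no linear independence. *)
Definition bounded_graph (G : set (V * R)) :=
  [/\ G (0, 0),
      forall v a w b (s : R), G (v, a) -> G (w, b) -> G (s%:C *: v + w, s * a + b) &
      forall v a, G (v, a) -> D v -> a <= 1].

(** The one-vector step of Hahn-Banach. A value [c] at [x] is admissible when it lies above every (a
    - 1) / s coming from v - s x in [D] and below every (1 - b) / t coming from w + t x in [D]; the
    supremum of the former works. *)
Lemma bounded_graph_extend (G : set (V * R)) (x : V) : bounded_graph G ->
  exists G' : set (V * R), [/\ bounded_graph G', G `<=` G' & exists c, G' (x, c)].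
Proof.
move=> [G0 Glin GD].
pose A : set R := [set y | exists v a s, [/\ 0 < s, G (v, a), D (v - s%:C *: x) &
  y = (a - 1) / s]].
have AP v a s w b t : 0 < s -> 0 < t -> G (v, a) -> G (w, b) ->
    D (v - s%:C *: x) -> D (w + t%:C *: x) -> (a - 1) / s <= (1 - b) / t.
  move=> s0 t0 Gva Gwb Dv Dw.
  have st0 : 0 < s + t by rewrite addr_gt0.
  have Gz : G ((t / (s + t))%:C *: v + ((s / (s + t))%:C *: w + 0),
      t / (s + t) * a + (s / (s + t) * b + 0)).
    by apply: (Glin) => //; exact: Glin.
  have := GD _ _ Gz.
  (* The convex combination of v - s x and w + t x with weights t / (s + t) and s / (s + t)
     eliminates [x], so the bound on [G] applies to it. *)
  rewrite !addr0 => H.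
  have : D ((t / (s + t))%:C *: v + (s / (s + t))%:C *: w).
    have -> : (t / (s + t))%:C *: v + (s / (s + t))%:C *: w =
      (t / (s + t))%:C *: (v - s%:C *: x) + (s / (s + t))%:C *: (w + t%:C *: x).
      rewrite scalerBr scalerDr !scalerA -!rmorphM.
      rewrite (_ : s / (s + t) * t = t / (s + t) * s); last by ring.
      by rewrite addrACA addNr addr0.
    apply: convD => //; first by rewrite divr_ge0// ltW.
      by rewrite divr_ge0// ltW.
    by rewrite -mulrDl (addrC t) divff// gt_eqF.
  move=> /H; rewrite !(mulrAC _ (s + t)^-1) -mulrDl ler_pdivrMr// mul1r => K.
  rewrite ler_pdivrMr// mulrAC ler_pdivlMr//; nra.
(* Absorption in the directions [x] and [-x] makes [A] bounded above and nonempty, so its supremum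
   is meaningful. *)
have [e e0 De] := absD x.
have [e' e'0 De'] := absD (- x).
have A0 : A !=set0.
  exists ((0 - 1) / e'); exists 0, 0, e'; split=> //.
  by rewrite sub0r -scalerN.
have Aub b w t : 0 < t -> G (w, b) -> D (w + t%:C *: x) -> sup A <= (1 - b) / t.
  move=> t0 Gwb Dw; apply: ge_sup => // _ [v [a [s [s0 Gva Dv ->]]]].
  exact: (AP v a s w b t).
have Ahub : has_ubound A.
  exists ((1 - 0) / e) => _ [v [a [s [s0 Gva Dv ->]]]].
  by apply: (AP v a s 0 0 e) => //; rewrite add0r.
pose c := sup A.
exists [set u | exists v a s, G (v, a) /\ u = (v + s%:C *: x, a + s * c)].
split; first split.
- by exists 0, 0, 0; rewrite scale0r mul0r !addr0.
- move=> _ _ _ _ s [v [a [s1 [Gva [-> ->]]]]] [w [b [s2 [Gwb [-> ->]]]]].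
  exists (s%:C *: v + w), (s * a + b), (s * s1 + s2); split; first exact: Glin.
  congr pair; last by ring.
  by rewrite rmorphD rmorphM scalerDr scalerDl scalerA addrACA.
- move=> _ _ [v [a [s [Gva [-> ->]]]]] Dv.
  have [s0|s0|s0] := ltgtP s 0.
  + have s0' : 0 < - s by rewrite oppr_gt0.
    have : (a - 1) / (- s) <= c.
      apply: ub_le_sup => //; exists v, a, (- s); split => //.
      by rewrite rmorphN scaleNr opprK.
    by rewrite ler_pdivrMr//; lra.
  + have := Aub _ _ _ s0 Gva Dv; rewrite -/c ler_pdivlMr//; lra.
  + by move: Dv; rewrite s0 scale0r mul0r !addr0; exact: GD.
- by move=> [v a] Gva; exists v, a, 0; rewrite scale0r mul0r !addr0.
- by exists c; exists 0, 0, 1; rewrite scale1r mul1r !add0r.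
Qed.

(** Only a finite real basis has to be covered, so induction replaces Zorn's lemma. *)
Lemma bounded_graph_extends (G : set (V * R)) (xs : seq V) : bounded_graph G ->
  exists G' : set (V * R), [/\ bounded_graph G', G `<=` G' &
    forall x, x \in xs -> exists c, G' (x, c)].
Proof.
move=> bG; elim: xs => [|x xs [G1 [bG1 GG1 G1xs]]].
  by exists G; split.
have [G2 [bG2 G12 [c G2x]]] := bounded_graph_extend x bG1.
exists G2; split=> //; first exact: subset_trans GG1 G12.
move=> y; rewrite inE => /predU1P[->|/G1xs[b G1y]]; first by exists c.
by exists b; exact: G12.
Qed.

(** Starting point of the extension: if t p were in [D] with t > 1, then [p], lying between 0 and t
    p, would be in [D]. *)
Lemma bounded_graph_line (p : V) : ~ D p ->
  bounded_graph [set u | exists t : R, u = (t%:C *: p, t)].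
Proof.
move=> nDp; split.
- by exists 0; rewrite scale0r.
- move=> _ _ _ _ s [t [-> ->]] [t' [-> ->]]; exists (s * t + t').
  by rewrite rmorphD rmorphM scalerDl scalerA.
- move=> _ _ [t [-> ->]] Dt; rewrite leNgt; apply/negP => t1; apply: nDp.
  have t0 : 0 < t by rewrite (lt_trans _ t1).
  have [e e0 De] := absD 0; rewrite scaler0 in De.
  have -> : p = (1 / t)%:C *: (t%:C *: p) + (1 - 1 / t)%:C *: 0.
    by rewrite scaler0 addr0 scalerA -rmorphM divfK ?gt_eqF// scale1r.
  apply: convD => //; last by rewrite subrKC.
    by rewrite divr_ge0// ltW.
  by rewrite subr_ge0 ler_pdivrMr// mul1r ltW.
Qed.

End real_graph.

Lemma complex_separation (n : nat) (D : set 'rV[R[i]]_n) (p : 'rV[R[i]]_n) :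
  (forall x y (s t : R), 0 <= s -> 0 <= t -> s + t = 1 ->
    D x -> D y -> D (s%:C *: x + t%:C *: y)) ->
  (forall x, exists2 e : R, 0 < e & D (e%:C *: x)) -> ~ D p ->
  exists l : 'cV[R[i]]_n, complex.Re ((p *m l) 0 0) = 1 /\
    forall w, D w -> complex.Re ((w *m l) 0 0) <= 1.
Proof.
move=> convD absD nDp.
have bG0 := bounded_graph_line convD absD nDp.
pose xs := [seq (delta_mx 0 j : 'rV[R[i]]_n) | j <- enum 'I_n] ++
  [seq (0 +i* 1) *: (delta_mx 0 j : 'rV[R[i]]_n) | j <- enum 'I_n].
have [G [[Gz Glin GD] G0 Gxs]] := bounded_graph_extends convD absD xs bG0.
have /choice[a aP] (j : 'I_n) : exists c, G (delta_mx 0 j, c).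
  by apply: Gxs; rewrite mem_cat map_f// mem_enum.
have /choice[b bP] (j : 'I_n) : exists c, G ((0 +i* 1) *: delta_mx 0 j, c).
  apply: Gxs; rewrite mem_cat; apply/orP; right; apply/mapP; exists j => //.
  by rewrite mem_enum.
(* The real-linear form with coefficients [a j], [b j] on the real basis
   [e_j, i e_j] is the real part of the complex form with coefficients [a j - i b j]. *)
pose l : 'cV[R[i]]_n := \col_j (a j +i* (- b j)).
have lE w : G (w, complex.Re ((w *m l) 0 0)).
  have -> : w = \sum_j w 0 j *: delta_mx 0 j by exact: row_sum_delta.
  set w' := (X in G (X, _)).
  rewrite mulmx_suml summxE raddf_sum/= {}/w'.
  apply: (big_ind2 (fun v c => G (v, c))) => //.
    by move=> v c v' c' Gv Gv'; have := Glin _ _ _ _ 1 Gv Gv'; rewrite scale1r mul1r.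
  move=> j _.
  have := Glin _ _ _ _ (complex.Re (w 0 j)) (aP j)
    (Glin _ _ _ _ (complex.Im (w 0 j)) (bP j) Gz).
  rewrite !addr0 scalerA -scalerDl mulrC -complexE.
  rewrite -scalemxAl -rowE !mxE.
  by case: (w 0 j) => u v /=; congr (G (_, _)); ring.
exists l; split; last by move=> w; exact: GD (lE w).
set f := complex.Re _.
have D0 : D 0 by have [e _] := absD 0; rewrite scaler0.
have G1 : G (p, 1) by apply: G0; exists 1; rewrite scale1r.
(* Nothing so far says that [G] is single-valued at [p]. But all real multiples of [1 - f] are
   values of [G] at 0, which lies in [D], so they are at most 1; hence [f = 1]. *)
have Gp : G (0, 1 - f).
  have := Glin _ _ _ _ (-1) (lE p) G1.
  by rewrite rmorphN scaleN1r addNr mulN1r addrC.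
have GtD t : t * (1 - f) <= 1.
  have := Glin _ _ _ _ t Gp Gz; rewrite scaler0 !addr0 => /GD; exact.
apply/eqP; rewrite eq_sym -subr_eq0; apply/negPn/negP => f0.
have := GtD (2 / (1 - f)); rewrite divfK//; lra.
Qed.

End separation.

(** * Frames of discs and supporting half-spaces *)

Section convex_frame.
Local Open Scope complex_scope.
Variable R : realType.

Lemma convex_setC (V : lmodType R[i]) (D : set V) :
  convex_set (D : set (convex_lmodType V)) ->
  forall x y (s t : R), 0 <= s -> 0 <= t -> s + t = 1 ->
    D x -> D y -> D (s%:C *: x + t%:C *: y).
Proof.
move=> cD x y s t s0 t0 st Dx Dy.
have s0' : 0 <= s%:C by rewrite ler0c.
have s1' : s%:C <= 1 by rewrite (lecR s 1); lra.
have -> : t%:C = 1 - s%:C.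
  by rewrite -(rmorph1 (real_complex R)) -rmorphB -st addrAC subrr add0r.
by have := cD x y (Itv01 s0' s1') (mem_set Dx) (mem_set Dy); rewrite inE.
Qed.

Lemma convex_set_translate (V : lmodType R[i]) (D : set V) (z : V) :
  convex_set (D : set (convex_lmodType V)) ->
  forall x y (s t : R), 0 <= s -> 0 <= t -> s + t = 1 ->
    D (z + x) -> D (z + y) -> D (z + (s%:C *: x + t%:C *: y)).
Proof.
move=> cD x y s t s0 t0 st Dx Dy.
have -> : z + (s%:C *: x + t%:C *: y) = s%:C *: (z + x) + t%:C *: (z + y).
  by rewrite !scalerDr addrACA -scalerDl -rmorphD st scale1r.
exact: convex_setC.
Qed.

Section star.
Variables (V : lmodType R[i]) (D : set V).
Hypothesis convD : forall x y (s t : R), 0 <= s -> 0 <= t -> s + t = 1 ->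
  D x -> D y -> D (s%:C *: x + t%:C *: y).
Hypothesis D0 : D 0.

Lemma convex_star x (s : R) : 0 <= s <= 1 -> D x -> D (s%:C *: x).
Proof.
move=> /andP[s0 s1] Dx; rewrite -[_ *: _]addr0 -(scaler0 _ (1 - s)%:C).
by apply: convD => //; rewrite ?subr_ge0// subrKC.
Qed.

(** The weight missing from 1 is put on the point 0 of [D]. *)
Lemma convex_sum (T : Type) (r : seq T) (a : T -> R) (x : T -> V) :
  (forall i, 0 <= a i) -> (forall i, D (x i)) -> \sum_(i <- r) a i <= 1 ->
  D (\sum_(i <- r) (a i)%:C *: x i).
Proof.
move=> a0 Dx a1.
suff [y Dy ->] : exists2 y, D y &
    \sum_(i <- r) (a i)%:C *: x i = (\sum_(i <- r) a i)%:C *: y.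
  by apply: convex_star => //; rewrite a1 sumr_ge0.
elim: r {a1} => [|i r [y Dy IH]]; first by exists 0 => //; rewrite !big_nil scaler0.
rewrite !big_cons IH; set S := \sum_(j <- r) a j.
have S0 : 0 <= S by exact: sumr_ge0.
(* If the total weight is zero the barycenter cannot be normalized, and 0 is taken instead. *)
have [aS0|aS] := eqVneq (a i + S) 0.
  have ai : a i = 0 by have := a0 i; lra.
  exists 0 => //; rewrite aS0 ai scale0r add0r (_ : S = 0) ?scale0r//; lra.
exists ((a i / (a i + S))%:C *: x i + (S / (a i + S))%:C *: y).
  apply: convD => //; rewrite ?divr_ge0 ?addr_ge0//.
  by rewrite -mulrDl divff.
by rewrite scalerDr !scalerA -!rmorphM !(mulrC (a i + S)) !divfK.
Qed.

End star.

Lemma open_polydisc n (D : set 'rV[R[i]]_n) (z : 'rV[R[i]]_n) : open D -> D z ->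
  exists2 r : R, 0 < r &
    forall h : 'rV[R[i]]_n, (forall j, normc (h 0 j) < r) -> D (z + h).
Proof.
move=> oD Dz.
have /nbhs_ballP[e /= /Re_real_pos[-> e0] De] : nbhs z D by exact: open_nbhs_nbhs.
exists (complex.Re e) => // h hr; apply: De.
split=> [|i j]; first by rewrite ltcR.
rewrite (ord1 i) -ball_normE/=.
by rewrite !mxE opprD addrA subrr sub0r normrN normE ltcR.
Qed.

Lemma open_absorbing n (D : set 'rV[R[i]]_n) (z h : 'rV[R[i]]_n) : open D -> D z ->
  exists2 e : R, 0 < e & forall t : R[i], normc t <= e -> D (z + t *: h).
Proof.
move=> oD Dz; have [r r0 Dr] := open_polydisc oD Dz.
pose M := 1 + \sum_j normc (h 0 j).
have M0 : 0 < M by rewrite ltr_wpDr// sumr_ge0// => j _; exact: normc_ge0.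
exists (r / (M + 1)); first by rewrite divr_gt0// addr_gt0.
move=> t tr; apply: Dr => j; rewrite mxE normcM.
have hM : normc (h 0 j) <= M.
  rewrite /M (bigD1 j)//= addrCA lerDl addr_ge0 ?sumr_ge0 ?normc_ge0// => i _.
  exact: normc_ge0.
apply: le_lt_trans (ler_pM (normc_ge0 _) (normc_ge0 _) tr hM) _.
have M1 : 0 < M + 1 by rewrite addr_gt0.
by rewrite mulrAC ltr_pdivrMr// ltr_pM2l// ltrDl.
Qed.

Variables (n : nat) (D : set 'rV[R[i]]_n).
Hypothesis oD : open D.
Hypothesis convD : forall x y (s t : R), 0 <= s -> 0 <= t -> s + t = 1 ->
  D x -> D y -> D (s%:C *: x + t%:C *: y).
Hypothesis D0 : D 0.
Hypothesis noline : forall u, u != 0 -> exists t : R[i], ~ D (t *: u).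

Lemma disc_exits (u : 'rV[R[i]]_n) : u != 0 ->
  exists r : R, [/\ 0 < r, forall t, normc t <= r -> D (t *: u) &
    exists2 t, normc t <= 3 / 2 * r & ~ D (t *: u)].
Proof.
move=> u0.
have [e e0 De] := open_absorbing u oD D0.
apply: contrapT => nex.
have all k t : normc t <= (3 / 2) ^+ k * e -> D (t *: u).
  elim: k t => [|k IH] t tk.
    by rewrite -[_ *: _]add0r; apply: De; move: tk; rewrite expr0 mul1r.
  apply: contrapT => nDt; apply: nex; exists ((3 / 2) ^+ k * e); split => //.
    by rewrite mulr_gt0// exprn_gt0// divr_gt0.
  by exists t => //; rewrite mulrA -exprS.
have [t nDt] := noline u0; apply: nDt.
have [k] := exists_half_pow_le (normc t) e0.
rewrite ler_pdivrMr ?exprn_gt0// mulrC => tk.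
(* Two enlargements multiply the radius by 9/4, which exceeds 2. *)
apply: (all (2 * k)%N); apply: le_trans tk _; rewrite ler_pM2r// exprM.
by apply: lerXn2r; rewrite ?nnegrE ?sqr_ge0//; lra.
Qed.

(** Take [c = r] and [l] separating [D] from the exit point t u. Since [|l (t u)| >= 1] and
    [|t| <= 3 / 2 * r], the value of [l] at r u has modulus at least 2/3. *)
Lemma frame_step (u : 'rV[R[i]]_n) : u != 0 -> exists (c : R[i]) (l : 'cV[R[i]]_n),
  [/\ forall t, normc t <= 1 -> D (t *: (c *: u)),
      forall w, D w -> complex.Re ((w *m l) 0 0) < 1 &
      2 / 3 <= normc ((c *: u *m l) 0 0)].
Proof.
move=> u0; have [r [r0 rD [t tr nDt]]] := disc_exits u0.
have absD x : exists2 e : R, 0 < e & D (e%:C *: x).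
  have [e e0 De] := open_absorbing x oD D0; exists e => //.
  by rewrite -[_ *: _]add0r; apply: De; rewrite normcR// ltW.
have [l [lp lD]] := complex_separation convD absD nDt.
exists r%:C, l; split.
- move=> s s1; rewrite scalerA; apply: rD; rewrite normcM.
  rewrite (normcR (ltW r0)).
  by rewrite -[leRHS]mul1r ler_pM2r.
(* Openness makes the inequality strict: (1 + e) w is still in [D]. *)
- move=> w Dw; have [e e0 De] := open_absorbing w oD Dw.
  have : D ((1 + e)%:C *: w).
    rewrite rmorphD scalerDl scale1r; apply: De.
    by rewrite normcR// ltW.
  move=> /lD; rewrite -scalemxAl mxE; case: ((w *m l) 0 0) => a b /=; rewrite mul0r subr0.
  by move=> H; rewrite -(ltr_pM2l (_ : 0 < 1 + e)) ?addr_gt0//; lra.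
- move: lp; rewrite -!scalemxAl; move: (u *m l) => Y.
  rewrite !mxE !normcM (normcR (ltW r0)); move: (Y 0 0) => y lp.
  have : 1 <= normc (t * y).
    by have := ge_Re_normc (t * y); rewrite lp normr1.
  rewrite normcM => ty.
  have := ler_wpM2r (normc_ge0 y) tr; lra.
Qed.

Lemma frame_seq k : (k <= n)%N ->
  exists (v : nat -> 'rV[R[i]]_n) (l : nat -> 'cV[R[i]]_n),
  [/\ forall i, (i < k)%N -> forall t, normc t <= 1 -> D (t *: v i),
      forall i, (i < k)%N -> forall w, D w -> complex.Re ((w *m l i) 0 0) < 1,
      forall i, (i < k)%N -> 2 / 3 <= normc ((v i *m l i) 0 0) &
      forall i j, (i < j < k)%N -> (v j *m l i) 0 0 = 0].
Proof.
elim: k => [_|k IH kn].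
  by exists (fun=> 0), (fun=> 0); split=> // i j; rewrite ltn0 andbF.
have [v [l [v1 l1 vl vl0]]] := IH (ltnW kn).
(* The columns are the forms already built; with fewer columns than rows, [A] has a nonzero left
   kernel vector. *)
pose A : 'M[R[i]]_(n, k) := \matrix_(i, j) l j i 0.
have [u u0 uA] : exists2 u : 'rV[R[i]]_n, u != 0 & u *m A = 0.
  have : kermx A != 0.
    by rewrite kermx_eq0 /row_free neq_ltn (leq_ltn_trans (rank_leq_col A)).
  move=> /rowV0Pn[u /sub_kermxP uA u0]; by exists u.
have [c [m [cD mD cm]]] := frame_step u0.
exists (fun i => if i == k then c *: u else v i), (fun i => if i == k then m else l i).
split=> [i|i|i|i j].
- by rewrite ltnS leq_eqVlt; case: eqVneq => //= _; exact: v1.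
- by rewrite ltnS leq_eqVlt; case: eqVneq => //= _; exact: l1.
- by rewrite ltnS leq_eqVlt; case: eqVneq => //= _; exact: vl.
- move=> /andP[ij]; rewrite ltnS leq_eqVlt; case: eqVneq => /= [jk _|jk jk'].
    have ik : (i < k)%N by rewrite -jk.
    rewrite (ltn_eqF ik) -scalemxAl mxE.
    have /matrixP/(_ 0 (Ordinal ik)) := uA; rewrite !mxE => H.
    rewrite (eq_bigr (fun j => u 0 j * A j (Ordinal ik))) ?H ?mulr0// => j' _.
    by rewrite !mxE.
  by rewrite (ltn_eqF (ltn_trans ij jk')); apply: vl0; rewrite ij.
Qed.

Lemma convex_frame : exists V L : 'M[R[i]]_n,
  [/\ forall i t, normc t <= 1 -> D (t *: row i V),
      forall j w, D w -> complex.Re ((w *m L) 0 j) < 1 &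
      (2 / 3) ^+ n <= normc (\det V) * normc (\det L)].
Proof.
have [v [l [v1 l1 vl vl0]]] := frame_seq (leqnn n).
exists (\matrix_i v i), (\matrix_(i, j) l j i 0).
have mE (w : 'rV[R[i]]_n) (j : 'I_n) :
    (w *m \matrix_(i, j) l j i 0) 0 j = (w *m l j) 0 0.
  by rewrite !mxE; apply: eq_bigr => i _; rewrite !mxE.
split=> [i t|j w Dw|]; first by rewrite rowK; exact: v1.
  by rewrite mE; exact: l1.
have VLE i j : ((\matrix_i v i) *m (\matrix_(i, j) l j i 0)) i j =
    (v i *m l j) 0 0 :> R[i].
  by rewrite !mxE; apply: eq_bigr => k _; rewrite !mxE.
(* The product of the two matrices is upper triangular, while [det_trig] is about lower triangular
   ones; hence the transpose. *)
rewrite -normcM -det_mulmx -det_tr det_trig; last first.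
  by apply/is_trig_mxP => i j ij; rewrite mxE VLE vl0// ij/=.
rewrite (big_morph _ (@normcM R) (normc1 R)) -[in leLHS](card_ord n) -prodr_const.
apply: ler_prod => i _; rewrite mxE VLE vl// andbT; lra.
Qed.

End convex_frame.

(** * Jacobians *)

Section jacobian.
Variable K : numFieldType.

Lemma mx_norm_entry m n (M : 'M[K]_(m, n)) i j : `|M i j| <= `|M|.
Proof.
rewrite -[leRHS]/(mx_norm M) mx_normE -[leLHS]nngE num_le.
exact: (le_bigmax _ (fun p : 'I_m * 'I_n => `|M p.1 p.2|%:nng) (i, j)).
Qed.

Lemma mx_norm_le_max m n (M : 'M[K]_(m, n)) (c : K) :
  0 <= c -> (forall i j, `|M i j| <= c) -> `|M| <= c.
Proof.
move=> /nonnegP[{}c] Mc; rewrite -[leLHS]/(mx_norm M) mx_normE num_le.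
apply/bigmax_leP; split; first by rewrite -num_le /=.
by move=> [i j] _; rewrite -num_le; exact: Mc.
Qed.

Variables m n : nat.
Implicit Types (f : 'rV[K]_m -> 'rV[K]_n).

Lemma differentiable_row f (x : 'rV[K]_m) :
  (forall j, differentiable (fun w => f w 0 j : K^o) x) -> differentiable f x.
Proof.
move=> fx.
have -> : f = \sum_(j < n) (fun w => (f w 0 j : K^o) *: (delta_mx 0 j : 'rV[K]_n)).
  by apply/funext => w; rewrite fct_sumE [LHS]row_sum_delta.
by apply: differentiable_sum => j; exact: differentiableZl.
Qed.

(** The expansion of [f] is restricted to a coordinate line, whose direction has sup norm at most 1.
    Jacobian entries thus become one-variable derivatives, open to Cauchy's estimate. *)
Lemma jacobian_slice_approx f (a : 'rV[K]_m) (t : K) (k : 'I_m) (j : 'I_n) :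
  let g (s : K) := f (a + s *: delta_mx 0 k) 0 j in
  differentiable f (a + t *: delta_mx 0 k) ->
  forall e : K, 0 < e -> exists2 r : K, 0 < r & forall h, `|h| <= r ->
    `|g (t + h) - g t - 'J f (a + t *: delta_mx 0 k) k j * h| <= e * `|h|.
Proof.
move=> g fd e e0; have /diff_locally/eqaddoP/(_ e e0) := fd.
set b := a + t *: _ in fd *.
move=> /nbhs_ballP[r /= r0 fr]; exists (r / 2); first by rewrite divr_gt0.
move=> h hr; have hr' : `|h| < r.
  by rewrite (le_lt_trans hr)// ltr_pdivrMr// ltr_pMr// ltr1n.
have nd : `|h *: delta_mx 0 k : 'rV[K]_m| <= `|h|.
  rewrite normrZ ler_piMr//; apply: mx_norm_le_max => // i i'.
  by rewrite mxE normr_nat lern1 leq_b1.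
have := fr (h *: delta_mx 0 k); rewrite -ball_normE/= sub0r normrN.
rewrite (le_lt_trans nd hr') => /(_ isT) H.
apply: le_trans (_ : e * `|h *: delta_mx 0 k : 'rV[K]_m| <= _); last by rewrite ler_pM2l.
apply: le_trans H.
apply: le_trans (mx_norm_entry _ 0 j).
rewrite le_eqVlt; apply/orP; left; apply/eqP; congr `|_|.
rewrite !fctE /= !mxE /g scalerDl addrA (addrC (h *: _)) opprD addrA; congr (_ - _).
by rewrite linearZ_LR mxE mulrC; congr (_ * _).
Qed.

End jacobian.

Lemma jacobian_comp (K : numFieldType) (m n p : nat) (f : 'rV[K]_m -> 'rV[K]_n)
    (g : 'rV[K]_n -> 'rV[K]_p) (x : 'rV[K]_m) :
  differentiable f x -> differentiable g (f x) ->
  'J (g \o f) x = 'J f x *m 'J g (f x).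
Proof.
move=> fx gx; apply/row_matrixP => i; rewrite !rowE mulmxA /jacobian.
by rewrite !mul_rV_lin1 diff_comp.
Qed.

Section affine.
Variable K : numFieldType.

Lemma differentiable_affine m n (b : 'rV[K]_n) (A : 'M[K]_(m, n)) (x : 'rV[K]_m) :
  differentiable (fun w => b + w *m A) x.
Proof.
apply: differentiable_row => j.
have -> : (fun w : 'rV[K]_m => (b + w *m A) 0 j : K^o) =
    cst (b 0 j : K^o) + \sum_(i < m) (fun w : 'rV[K]_m => w 0 i *: (A i j : K^o)).
  by apply/funext => w; rewrite fctE fct_sumE !mxE.
apply: differentiableD; first exact: differentiable_cst.
apply: differentiable_sum => i; apply: differentiableZl.
exact: differentiable_coord.
Qed.

Lemma jacobian_slice m n (f : 'rV[K]_m -> 'rV[K]_n) (a : 'rV[K]_m) k j :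
  differentiable f a ->
  'd (fun t : K^o => f (a + t *: delta_mx 0 k) 0 j : K^o) 0 1 = 'J f a k j.
Proof.
move=> fa; apply: approx_diff1 => e e0.
have := @jacobian_slice_approx K m n f a 0 k j.
by rewrite /= scale0r addr0 => /(_ fa e e0).
Qed.

Lemma differentiable_slice m n (f : 'rV[K]_m -> 'rV[K]_n) (a : 'rV[K]_m) (t : K) k j :
  differentiable f (a + t *: delta_mx 0 k) ->
  differentiable (fun s : K^o => f (a + s *: delta_mx 0 k) 0 j : K^o) t.
Proof.
by move=> fa; apply: approx_differentiable => e e0; exact: jacobian_slice_approx fa _ e0.
Qed.

Lemma jacobian_affine m n (b : 'rV[K]_n) (A : 'M[K]_(m, n)) (x : 'rV[K]_m) :
  'J (fun w => b + w *m A) x = A.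
Proof.
apply/matrixP => k j; rewrite -jacobian_slice; last exact: differentiable_affine.
apply: approx_diff1 => e e0; exists 1 => // h _.
rewrite add0r scale0r addr0 mulmxDl -scalemxAl -rowE; move: (x *m A) => y.
rewrite !mxE (_ : _ - _ - _ = 0); last by ring.
by rewrite normr0 mulr_ge0// ltW.
Qed.

(** With x = h l, the error is c x^2 / (2 (2 - x)). The radius 1 / q forces both [|x| <= 1], hence
    [|2 - x| >= 1], and [|c| |l|^2 |h| <= e]. *)
Lemma moebius_approx (c l e : K) : 0 < e -> exists2 r : K, 0 < r & forall h, `|h| <= r ->
  `|c * (h * l / (2 - h * l)) - c * l / 2 * h| <= e * `|h|.
Proof.
move=> e0; pose q := 1 + `|l| + `|c| * `|l| ^+ 2 / e.
have cl0 : 0 <= `|c| * `|l| ^+ 2 by rewrite mulr_ge0// exprn_ge0.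
have q0 : 0 < q by rewrite ltr_wpDr ?ltr_wpDr// divr_ge0// ltW.
exists q^-1 => [|h hq]; first by rewrite invr_gt0.
have x1 : `|h * l| <= 1.
  rewrite normrM (le_trans (ler_wpM2r _ hq))// mulrC ler_pdivrMr// mul1r.
  by rewrite /q -addrA addrCA lerDl addr_ge0// divr_ge0// ltW.
have x2 : 1 <= `|2 - h * l|.
  have := lerB_dist (2 : K) (h * l); apply: le_trans.
  by rewrite normr_nat lerBrDr (natrD _ 1 1) lerD2l.
have x20 : 2 - h * l != 0 by rewrite -normr_gt0 (lt_le_trans _ x2).
have -> : c * (h * l / (2 - h * l)) - c * l / 2 * h =
    c * l ^+ 2 * h / (2 * (2 - h * l)) * h by field.
rewrite normrM ler_wpM2r// normf_div ler_pdivrMr; last first.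
  by rewrite normr_gt0 mulf_neq0// pnatr_eq0.
have -> : `|c * l ^+ 2 * h| = `|c| * `|l| ^+ 2 * `|h| by rewrite 2!normrM normrX.
have -> : `|2 * (2 - h * l)| = 2 * `|2 - h * l| by rewrite normrM normr_nat.
apply: le_trans (_ : e <= _); last first.
  rewrite ler_peMr ?(ltW e0)//.
  by rewrite -[leLHS]mulr1 ler_pM// ler1n.
apply: le_trans (ler_wpM2l cl0 hq) _; rewrite ler_pdivrMr// mulrDr.
by rewrite [e * (_ / e)]mulrC divfK ?gt_eqF// lerDr mulr_ge0 ?addr_ge0// ltW.
Qed.

(** Each coordinate applies x / (2 - x), the Cayley transform of the half-plane Re x < 1 onto the
    unit disc, which fixes 0 with derivative 1/2. *)
Definition halfplanes_map n (c : K) (L : 'M[K]_n) (z w : 'rV[K]_n) : 'rV[K]_n :=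
  \row_j (c * (((w - z) *m L) 0 j / (2 - ((w - z) *m L) 0 j))).

Lemma jacobian_halfplanes_map n (c : K) (L : 'M[K]_n) (z : 'rV[K]_n) :
  differentiable (halfplanes_map c L z) z ->
  'J (halfplanes_map c L z) z = (c / 2) *: L.
Proof.
move=> dz; apply/matrixP => k j; rewrite -jacobian_slice//.
have E t : halfplanes_map c L z (z + t *: delta_mx 0 k) 0 j =
    c * (t * L k j / (2 - t * L k j)).
  have X : ((z + t *: delta_mx 0 k - z) *m L) 0 j = t * L k j.
    by rewrite addrAC subrr add0r -scalemxAl -rowE !mxE.
  by rewrite mxE X.
rewrite [RHS]mxE mulrAC; apply: approx_diff1 => e e0.
have [r r0 rP] := moebius_approx c (L k j) e0.
have E0 : halfplanes_map c L z (z + 0 *: delta_mx 0 k) 0 j = 0.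
  by rewrite E mul0r mul0r mulr0.
exists r => [//|h hr]; rewrite add0r E E0 subr0; exact: rP.
Qed.

End affine.

(** * Volume elements *)

Section volumes.
Local Open Scope complex_scope.
Variable R : realType.

Lemma normc_sum (I : Type) (r : seq I) (P : pred I) (F : I -> R[i]) :
  normc (\sum_(i <- r | P i) F i) <= \sum_(i <- r | P i) normc (F i).
Proof.
elim/big_ind2 : _ => //; first by rewrite normc0.
by move=> x a y b xa yb; apply: le_trans (le_normcD _ _) _; exact: lerD.
Qed.

Lemma normc_det_le n (A : 'M[R[i]]_n) (C : R) :
  (forall i j, normc (A i j) <= C) -> normc (\det A) <= C ^+ n *+ n`!.
Proof.
move=> AC; rewrite /determinant; apply: le_trans (normc_sum _ _ _) _.
rewrite -card_Sn -sumr_const.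
apply: ler_sum => s _; rewrite normcM.
have -> : normc ((-1) ^+ s : R[i]) = 1.
  by apply/eqP; rewrite -(inj_eq (@complexI R)) -normE normr_sign.
rewrite mul1r (big_morph _ (@normcM R) (normc1 R)) -[in leRHS](card_ord n) -prodr_const.
by apply: ler_prod => i _; rewrite normc_ge0 AC.
Qed.

(** Cauchy's estimate with [M = 1] on coordinate discs bounds each entry by 8 / r, and the Leibniz
    formula has n! terms. *)
Lemma jacobian_det_bound n (f : 'rV[R[i]]_n -> 'rV[R[i]]_n) (a : 'rV[R[i]]_n) (r : R) :
  0 < r ->
  (forall h : 'rV[R[i]]_n, (forall j, normc (h 0 j) < r) ->
    differentiable f (a + h) /\ unit_ball (f (a + h))) ->
  normc (\det ('J f a)) <= (8 / r) ^+ n *+ n`!.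
Proof.
move=> r0 fr; apply: normc_det_le => k j.
have fa : differentiable f a.
  by have [] := fr 0; rewrite ?addr0// => i; rewrite mxE normc0.
have dr (t : R[i]) : normc t < r ->
    forall i, normc ((t *: delta_mx 0 k : 'rV[R[i]]_n) 0 i) < r.
  by move=> tr i; rewrite !mxE eqxx/=; case: (i == k); rewrite ?mulr1 ?mulr0 ?normc0.
rewrite -jacobian_slice// -[8]mulr1; apply: cauchy_estimate => // t /dr/fr[ft fu].
  exact: differentiable_slice ft.
move: fu; rewrite /unit_ball/= (bigD1 j)//= => H.
have : normc (f (a + t *: delta_mx 0 k) 0 j) ^+ 2 <= 1.
  apply: le_trans (ltW H); rewrite lerDl sumr_ge0// => i _; exact: sqr_ge0.
by rewrite expr_le1// normc_ge0.
Qed.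

End volumes.

(** * Test maps and the lower bound for the quotient *)

Section quotient.
Local Open Scope complex_scope.
Variables (R : realType) (n : nat).
Hypothesis n2 : (2 <= n)%N.
Implicit Types (z w : 'rV[R[i]]_n).

(** Scaling by 1 / sqrt n maps the unit polydisc into the unit ball, and the unit ball into the l^1
    unit ball; both test maps use it. *)
Let s : R := (Num.sqrt n%:R)^-1.

Let n_gt0 : 0 < n%:R :> R. Proof. by rewrite ltr0n (leq_trans _ n2). Qed.
Let s_gt0 : 0 < s. Proof. by rewrite invr_gt0 sqrtr_gt0. Qed.
Let s2 : s ^+ 2 = n%:R^-1. Proof. by rewrite exprVn sqr_sqrtr// ltW. Qed.

Lemma unit_ball_polydisc z : (forall j, normc (z 0 j) < n%:R^-1) -> unit_ball z.
Proof.
move=> zn; rewrite /unit_ball/=.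
apply: le_lt_trans (_ : \sum_(j < n) n%:R^-1 ^+ 2 < 1).
  by apply: ler_sum => j _; rewrite ler_sqr ?nnegrE ?normc_ge0 ?invr_ge0 ?ltW.
rewrite sumr_const card_ord -[_ *+ n]mulr_natr.
have -> : n%:R^-1 ^+ 2 * n%:R = n%:R^-1 :> R by field; rewrite gt_eqF.
by rewrite invf_lt1// ltr1n.
Qed.

(** A point with real part below 1 is closer to 0 than to 2. *)
Lemma normc_halfplane (x : R[i]) : complex.Re x < 1 -> normc (x / (2 - x)) < 1.
Proof.
move=> x1; rewrite normcM normcV ltr_pdivrMr ?mul1r.
  case: x x1 => a b /= a1.
  rewrite addr0 sub0r sqrrN ltr_sqrt; last first.
    by rewrite ltr_pwDl ?sqr_ge0// exprn_gt0//; lra.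
  by rewrite ltrD2r; nra.
rewrite lt_neqAle normc_ge0 andbT eq_sym; apply/eqP => /eq0_normc/eqP.
by rewrite subr_eq0 => /eqP x2; move: x1; rewrite -x2/=; lra.
Qed.

Lemma halfplanes_map_holomorphic (D : set 'rV[R[i]]_n) (L : 'M[R[i]]_n) z :
  (forall j w, D w -> complex.Re (((w - z) *m L) 0 j) < 1) ->
  holomorphic_maps D (@unit_ball R n) (halfplanes_map s%:C L z).
Proof.
move=> DL; split=> [w Dw|_ [w Dw <-]].
  apply: differentiable_row => j.
  have dX : differentiable (fun w => ((w - z) *m L) 0 j : R[i]^o) w.
    have -> : (fun w : 'rV[R[i]]_n => ((w - z) *m L) 0 j : R[i]^o) =
        (fun v : 'rV[R[i]]_n => v 0 j : R[i]^o) \o (fun w => - (z *m L) + w *m L).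
      by apply/funext => v; rewrite /= mulmxBl addrC.
    exact: differentiable_comp (differentiable_affine _ _ _) (differentiable_coord _ _ _).
  have -> : (fun w => halfplanes_map s%:C L z w 0 j : R[i]^o) =
      cst (s%:C : R[i]^o) * ((fun w => ((w - z) *m L) 0 j : R[i]^o) *
      (fun w => (((cst (2 : R[i]^o)) - (fun w => ((w - z) *m L) 0 j : R[i]^o)) w)^-1)).
    by apply/funext => v; rewrite /halfplanes_map mxE.
  have n0 : ((cst (2 : R[i]^o)) - (fun w => ((w - z) *m L) 0 j : R[i]^o)) w != 0.
    rewrite !fctE subr_eq0; apply/eqP => x2; have := DL j w Dw.
    by rewrite -x2/=; lra.
  have dN := differentiableV (differentiableB (differentiable_cst (2 : R[i]^o) w) dX) n0.
  exact: differentiableM (differentiable_cst _ _) (differentiableM dX dN).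
rewrite /unit_ball/=.
have H j : normc (halfplanes_map s%:C L z w 0 j) ^+ 2 <
    n%:R^-1.
  rewrite mxE normcM exprMn normcR ?ltW// s2 -[ltRHS]mulr1 ltr_pM2l ?invr_gt0//.
  by rewrite expr_lt1 ?normc_ge0// normc_halfplane// DL.
apply: lt_le_trans (_ : \sum_(j < n) n%:R^-1 <= 1); last first.
  by rewrite sumr_const card_ord -[_^-1 *+ _]mulr_natl mulfV ?gt_eqF.
(* Strictness of the sum needs at least one coordinate. *)
pose i0 : 'I_n := Ordinal (ltnW n2).
rewrite (bigD1 i0)//= [ltRHS](bigD1 i0)//=; apply: ltr_leD => //.
by apply: ler_sum => j _; exact: ltW.
Qed.

Lemma simplex_map_holomorphic (D : set 'rV[R[i]]_n) (V : 'M[R[i]]_n) z :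
  convex_set D -> D z ->
  (forall i t, normc t <= 1 -> D (z + t *: row i V)) ->
  holomorphic_maps (@unit_ball R n) D (fun w => z + w *m (s%:C *: V)).
Proof.
move=> cD Dz DV; split=> [w _|_ [w wB <-]]; first exact: differentiable_affine.
pose D' := [set w | D (z + w)].
have convD' := convex_set_translate (z := z) cD.
have D'0 : D' 0 by rewrite /D'/= addr0.
(* The phase of each coordinate is absorbed by the disc through [row i V], leaving real weights
   [s * normc (w 0 i)]. For a zero coordinate, x / 0 = 0 makes the phase 0. *)
have -> : w *m (s%:C *: V) =
    \sum_(i <- enum 'I_n) (s * normc (w 0 i))%:C *:
      ((w 0 i / (normc (w 0 i))%:C) *: row i V).
  rewrite big_enum/= {1}(row_sum_delta w) mulmx_suml; apply: eq_bigr => i _.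
  rewrite -scalemxAl -scalemxAr -rowE !scalerA; congr (_ *: _).
  have [->|w0] := eqVneq (w 0 i) 0; first by rewrite !mul0r normc0 !mulr0.
  rewrite rmorphM mulrAC -!mulrA.
  have : (normc (w 0 i))%:C != 0 by rewrite -normE normr_eq0.
  by move=> nw0; rewrite mulVf// mulr1 mulrC.
apply: (convex_sum convD' D'0) => [i|i|].
- by rewrite mulr_ge0 ?normc_ge0// ltW.
- apply: DV; rewrite normcM normcV normcR ?normc_ge0//.
  by have [->|w0] := eqVneq (normc (w 0 i)) 0; rewrite ?mul0r// divff.
- rewrite big_enum/=.
  (* Arithmetic-geometric mean inequality, with s^2 = 1 / n. *)
  apply: le_trans (_ : \sum_(i < n) (n%:R^-1 + normc (w 0 i) ^+ 2) / 2 <= 1).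
    apply: ler_sum => i _; rewrite -s2.
    by have := sqr_ge0 (s - normc (w 0 i)); nra.
  rewrite -mulr_suml big_split/= sumr_const card_ord.
  rewrite -[_^-1 *+ _]mulr_natl mulfV ?gt_eqF//.
  by move: wB; rewrite /unit_ball/=; lra.
Qed.

Lemma abs_jac2_scale (f : 'rV[R[i]]_n -> 'rV[R[i]]_n) z (c : R) (A : 'M[R[i]]_n) :
  0 <= c -> 'J f z = c%:C *: A -> abs_jac2 f z = (c ^+ 2) ^+ n * normc (\det A) ^+ 2.
Proof.
move=> c0 fA; rewrite /abs_jac2 fA detZ normcM exprMn -exprM mulnC exprM.
by congr (_ ^+ 2 * _); rewrite -rmorphXn normcR// exprn_ge0.
Qed.

(** The bound is uniform in [psi]: on [D] it makes c_D finite, and on the ball it controls the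
    compositions that keep k_D away from 0. *)
Lemma abs_jac2_bounded (D : set 'rV[R[i]]_n) z (r : R) : 0 < r ->
  (forall h : 'rV[R[i]]_n, (forall j, normc (h 0 j) < r) -> D (z + h)) ->
  exists2 K : R, 0 < K & forall psi, holomorphic_maps D (@unit_ball R n) psi ->
    abs_jac2 psi z <= K.
Proof.
move=> r0 Dr; exists (((8 / r) ^+ n *+ n`!) ^+ 2).
  by rewrite exprn_gt0// pmulrn_lgt0 ?fact_gt0// exprn_gt0// divr_gt0.
move=> psi [dpsi psiB].
rewrite /abs_jac2 ler_sqr ?nnegrE ?normc_ge0//; last first.
  by rewrite mulrn_wge0// exprn_ge0// divr_ge0// ltW.
apply: jacobian_det_bound => // h /Dr Dh; split; first exact: dpsi.
by apply: psiB; exists (z + h).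
Qed.

(** The half-plane map [F] bounds c_D from below and the simplex map [P] bounds k_D from above. The
    opposite bounds ensure that [fine] and the division never take default values. *)
Lemma quotient_frame (D : set 'rV[R[i]]_n) (V L : 'M[R[i]]_n) z :
  open D -> convex_set D -> D z ->
  (forall i t, normc t <= 1 -> D (z + t *: row i V)) ->
  (forall j w, D w -> complex.Re (((w - z) *m L) 0 j) < 1) ->
  \det V != 0 -> \det L != 0 ->
  (normc (\det V * \det L)) ^+ 2 / (4 * n%:R ^+ 2) ^+ n <= quotient_invariant D z.
Proof.
move=> oD cD Dz DV DL V0 L0.
have holF := halfplanes_map_holomorphic DL.
set F := halfplanes_map s%:C L z in holF.
have F0 : F z = 0 by apply/rowP => j; rewrite [LHS]mxE subrr mul0mx !mxE mul0r mulr0.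
have JF : abs_jac2 F z = ((s / 2) ^+ 2) ^+ n * normc (\det L) ^+ 2.
  apply: abs_jac2_scale; first by rewrite divr_ge0// ltW.
  rewrite jacobian_halfplanes_map; last exact: holF.1.
  rewrite rmorphM; congr (_ * _ *: _).
  by rewrite fmorphV rmorph_nat.
have holP := simplex_map_holomorphic cD Dz DV.
set P := (fun _ => _) in holP.
have P0 : P 0 = z by rewrite /P mul0mx addr0.
have JP : abs_jac2 P 0 = (s ^+ 2) ^+ n * normc (\det V) ^+ 2.
  by apply: abs_jac2_scale; [exact: ltW|exact: jacobian_affine].
clearbody F P.
have nV : 0 < normc (\det V).
  by rewrite lt_neqAle normc_ge0 eq_sym andbT; apply: contra_neq V0; exact: eq0_normc.
have nL : 0 < normc (\det L).
  by rewrite lt_neqAle normc_ge0 eq_sym andbT; apply: contra_neq L0; exact: eq0_normc.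
have JF0 : 0 < abs_jac2 F z by rewrite JF mulr_gt0 ?exprn_gt0 ?divr_gt0.
have JP0 : 0 < abs_jac2 P 0 by rewrite JP mulr_gt0 ?exprn_gt0.
have [r r0 Dr] := open_polydisc oD Dz.
have [K _ KP] := abs_jac2_bounded r0 Dr.
have c_ge : ((abs_jac2 F z)%:E <= caratheodory_volume D z)%E.
  by apply: ereal_sup_ubound; exists F.
have c_le : (caratheodory_volume D z <= K%:E)%E.
  by apply: ge_ereal_sup => _ [psi [hpsi _] <-]; rewrite lee_fin; exact: KP.
have k_le : (kobayashi_volume D z <= ((abs_jac2 P 0)^-1)%:E)%E.
  by apply: ereal_inf_lbound; exists P => //; rewrite inver gt_eqF.
(* For a competitor [psi], the map [F \o psi] sends the ball to itself, so its Jacobian is bounded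
   by a constant; the chain rule then bounds that of [psi]. A vanishing Jacobian contributes +oo. *)
have [delta delta0 k_ge] : exists2 d : R, 0 < d & (d%:E <= kobayashi_volume D z)%E.
  have n0 : 0 < n%:R^-1 :> R by rewrite invr_gt0.
  have [K' K'0 K'P] : exists2 K' : R, 0 < K' & forall f,
      holomorphic_maps (@unit_ball R n) (@unit_ball R n) f -> abs_jac2 f 0 <= K'.
    apply: (abs_jac2_bounded n0) => h hn; rewrite add0r.
    exact: unit_ball_polydisc.
  exists (abs_jac2 F z / K'); first exact: divr_gt0 JF0 K'0.
  apply: le_ereal_inf_tmp => _ [psi [[dpsi psiD] psi0] <-].
  rewrite inver; case: eqVneq => [//|J0]; first by rewrite leey.
  have J0' : 0 < abs_jac2 psi 0 by rewrite lt_neqAle eq_sym J0 sqr_ge0.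
  rewrite lee_fin ler_pdivrMr// mulrC -ler_pdivrMr ?invr_gt0// invrK.
  have B0 : unit_ball (0 : 'rV[R[i]]_n).
    by apply: unit_ball_polydisc => j; rewrite mxE normc0.
  have -> : abs_jac2 F z * abs_jac2 psi 0 = abs_jac2 (F \o psi) 0.
    have dF : differentiable F (psi 0) by rewrite psi0; exact: holF.1.
    rewrite /abs_jac2 (jacobian_comp (dpsi _ B0) dF) det_mulmx normcM exprMn psi0.
    exact: mulrC.
  apply: K'P; split=> [h hB|_ [h hB <-]].
    have Dpsih : D (psi h) by apply: psiD; exists h.
    exact: differentiable_comp (dpsi _ hB) (holF.1 _ Dpsih).
  by apply: holF.2; exists (psi h) => //; apply: psiD; exists h.
have cE : caratheodory_volume D z = (fine (caratheodory_volume D z))%:E.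
  by rewrite fineK// fin_real// (lt_le_trans _ c_ge) ?ltNyr// (le_lt_trans c_le) ?ltry.
have kE : kobayashi_volume D z = (fine (kobayashi_volume D z))%:E.
  by rewrite fineK// fin_real// (lt_le_trans _ k_ge) ?ltNyr// (le_lt_trans k_le) ?ltry.
rewrite /quotient_invariant.
rewrite cE lee_fin in c_ge; rewrite kE !lee_fin in k_le k_ge.
have k0 : 0 < fine (kobayashi_volume D z) by exact: lt_le_trans k_ge.
rewrite ler_pdivlMr//.
apply: le_trans (_ : abs_jac2 F z * abs_jac2 P 0 * fine (kobayashi_volume D z) <= _).
  rewrite ler_pM2r// JF JP normcM expr_div_n s2.
  have E : (n%:R^-1 / 2 ^+ 2) ^+ n * n%:R^-1 ^+ n = ((4 * n%:R ^+ 2) ^+ n)^-1 :> R.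
    by rewrite -exprMn -[RHS]exprVn; congr (_ ^+ n); field; rewrite gt_eqF.
  by rewrite -E le_eqVlt; apply/orP; left; apply/eqP; ring.
apply: le_trans c_ge; rewrite -mulrA ler_piMr ?(ltW JF0)//.
by rewrite -ler_pdivlMl// mulr1.
Qed.

End quotient.

(** This amounts to 3 / (4 n (4^n - 1)) <= 1 / (9 n^2), written without subtraction. It fails at n =
    1. *)
Lemma pow4_bound n : (2 <= n)%N -> (27 * n + 4 <= 4 * 4 ^ n)%N.
Proof.
elim: n => // -[//|[//|n] IH] _.
by have := IH isT; rewrite (expnS 4 n.+2); lia.
Qed.

Theorem corollary1p3 (R : realType) (n : nat) (hn : (2 <= n)%N)
    (D : set 'rV[R[i]]_n) (hD : convex_domain D) (hnd : nondegenerate_domain D) :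
  forall z : 'rV[R[i]]_n, D z ->
    (3 / (4 * n%:R * (4 ^+ n - 1))) ^+ n <= quotient_invariant D z.
Proof.
case: hD => -[_ oD _] cD z Dz.
pose D' := [set w | D (z + w)].
have oD' : open D'.
  rewrite (_ : D' = (fun w => z + w *m 1%:M) @^-1` D).
    apply: open_comp => // w _.
    exact: differentiable_continuous (differentiable_affine _ _ _).
  by apply/seteqP; split=> w; rewrite /D'/= mulmx1.
have convD' := convex_set_translate (z := z) cD.
have D'0 : D' 0 by rewrite /D'/= addr0.
have noline u : u != 0 -> exists t : R[i], ~ D' (t *: u).
  move=> u0; apply: contrapT => nex; apply: hnd; exists z, u; split => // t.
  by apply: contrapT => nD; apply: nex; exists t.
have [V [L [DV DL VL]]] := convex_frame oD' convD' D'0 noline.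
have VL0 : 0 < normc (\det V) * normc (\det L).
  by apply: lt_le_trans VL; rewrite exprn_gt0// divr_gt0.
have V0 : \det V != 0 by apply: contraTneq VL0 => ->; rewrite normc0 mul0r ltxx.
have L0 : \det L != 0 by apply: contraTneq VL0 => ->; rewrite normc0 mulr0 ltxx.
have DL' j w : D w -> complex.Re (((w - z) *m L) 0 j) < 1.
  by move=> Dw; apply: DL; rewrite /D'/= subrKC.
apply: le_trans (quotient_frame hn oD cD Dz DV DL' V0 L0).
rewrite normcM.
have N0 : 0 < n%:R :> R by rewrite ltr0n (leq_trans _ hn).
(* The middle term equals (1 / (9 n^2))^n, so what remains is a comparison of bases. *)
apply: le_trans (_ : ((2 / 3) ^+ n) ^+ 2 / (4 * n%:R ^+ 2) ^+ n <= _); last first.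
  rewrite ler_pM2r ?invr_gt0 ?exprn_gt0 ?mulr_gt0 ?exprn_gt0//.
  by rewrite ler_sqr ?nnegrE ?(ltW VL0)// exprn_ge0// divr_ge0.
have := pow4_bound hn; rewrite -(ler_nat R) natrD !natrM natrX => n4.
have p0 : 0 < 4 ^+ n - 1 :> R by nra.
rewrite -exprM mulnC exprM -expr_div_n lerXn2r ?nnegrE//.
  by rewrite divr_ge0 ?mulr_ge0 ?(ltW p0) ?(ltW N0).
have -> : (2 / 3) ^+ 2 / (4 * n%:R ^+ 2) = 1 / (9 * n%:R ^+ 2) :> R.
  by field; rewrite gt_eqF.
rewrite ler_pdivrMr ?mulr_gt0// mulrAC ler_pdivlMr ?mulr_gt0 ?exprn_gt0//.
nra.
Qed.
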